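(* Let $m$ and $n$ be positive integers and let $\kappa=m+n$. For $r\ge0$ let $(m^r)$ denote the partition with $r$ parts all equal to $m$. Then, as formal power series in $q$, \[ \lim_{r\to\infty} q^{-m\binom{r}{2}} P_{(m^r)}(1,q,q^2,\dots;q^n) =\frac{(q^{\kappa};q^{\kappa})_{\infty}^{n-1}}{(q;q)_{\infty}^n} \prod_{1\leq i<j\leq n} \theta(q^{j-i};q^{\kappa}) =\frac{(q^{\kappa};q^{\kappa})_{\infty}^{m-1}}{(q;q)_{\infty}^m} \prod_{1\leq i<j\leq m} \theta(q^{j-i};q^{\kappa}). \]
   Context: For a partition $\lambda=(\lambda_1,\lambda_2,\dots)$, $l(\lambda)$ is the number of positive parts and $m_i=m_i(\lambda)$ is the multiplicity of parts equal to $i$. Notation: $(a;q)_k=(1-a)(1-aq)\cdots(1-aq^{k-1})$ for $k\in\{0,1,2,\dots\}\cup\{\infty\}$; $\theta(a;q)=(a;q)_\infty(q/a;q)_\infty$. The Hall–Littlewood polynomial in $N$ variables $x=(x_1,\dots,x_N)$ with parameter $t$ is $P_\lambda(x;t)=\frac{1}{v_\lambda(t)}\sum_{w\in S_N} w\Big(x_1^{\lambda_1}\cdots x_N^{\lambda_N}\prod_{i<j}\frac{x_i-tx_j}{x_i-x_j}\Big)$ for $l(\lambda)\le N$, where $S_N$ permutes the variables and $v_\lambda(t)=\prod_{i=0}^N (t;t)_{m_i}/(1-t)^{m_i}$ with $m_0=N-l(\lambda)$; $P_\lambda(x;t)=0$ if $l(\lambda)>N$. These are stable under setting $x_N=0$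 and so define symmetric functions in infinitely many variables; $P_\lambda(1,q,q^2,\dots;t)$ denotes the specialisation $x_i=q^{i-1}$ ($i\ge1$), a formal power series in $q$. The limit is in the sense of formal power series (coefficientwise stabilisation). *)

(* Defs.v *)
From HB Require Import structures.
From mathcomp Require Import all_boot all_order all_algebra all_fingroup.
From mathcomp Require Import boolp classical_sets.
From mathcomp Require Import mpoly.

Set Implicit Arguments.
Unset Strict Implicit.
Unset Printing Implicit Defensive.

Import GRing.Theory.
Local Open Scope ring_scope.

(* A wrapper around [nat -> K], so that [*] is the Cauchy product and not the
   pointwise one. *)
Record fps (K : fieldType) := Fps { fps_coef : nat -> K }.

HB.instance Definition _ (K : fieldType) := gen_eqMixin (fps K).
HB.instance Definition _ (K : fieldType) := gen_choiceMixin (fps K).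

Section FpsRing.
Variable K : fieldType.
Implicit Types f g h : fps K.

Lemma fpsP f g : (forall k, fps_coef f k = fps_coef g k) -> f = g.
Proof. by case: f g => [f] [g] /= /funext ->. Qed.

Definition fps_of_poly (p : {poly K}) : fps K := Fps (fun k => p`_k).

Definition fps0 := @Fps K (fun=> 0).
Definition fps_opp f := Fps (fun k => - fps_coef f k).
Definition fps_add f g := Fps (fun k => fps_coef f k + fps_coef g k).
Definition fps1 := fps_of_poly 1.
Definition fps_mul f g :=
  Fps (fun k => \sum_(i < k.+1) fps_coef f i * fps_coef g (k - i)).

Fact fps_addA : associative fps_add.
Proof. by move=> f g h; apply: fpsP => k /=; rewrite addrA. Qed.
Fact fps_addC : commutative fps_add.
Proof. by move=> f g; apply: fpsP => k /=; rewrite addrC. Qed.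
Fact fps_add0 : left_id fps0 fps_add.
Proof. by move=> f; apply: fpsP => k /=; rewrite add0r. Qed.
Fact fps_addN : left_inverse fps0 fps_opp fps_add.
Proof. by move=> f; apply: fpsP => k /=; rewrite addNr. Qed.

HB.instance Definition _ :=
  GRing.isZmodule.Build (fps K) fps_addA fps_addC fps_add0 fps_addN.

Definition fps_trunc n f : {poly K} := \poly_(i < n) fps_coef f i.

Lemma coef_fps_mul n f g k (p q : {poly K}) : (k < n)%N ->
    (forall i, (i < n)%N -> p`_i = fps_coef f i) ->
    (forall i, (i < n)%N -> q`_i = fps_coef g i) ->
  fps_coef (fps_mul f g) k = (p * q)`_k.
Proof.
move=> kn pf qg; rewrite coefM /=; apply: eq_bigr => i _.
rewrite pf ?qg //; first exact: leq_ltn_trans (leq_subr _ _) kn.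
by apply: leq_ltn_trans kn; rewrite -ltnS.
Qed.

Lemma coef_fps_trunc n f i : (i < n)%N -> (fps_trunc n f)`_i = fps_coef f i.
Proof. by rewrite coef_poly => ->. Qed.

Lemma coef_mul_trunc n f g i : (i < n)%N ->
  (fps_trunc n f * fps_trunc n g)`_i = fps_coef (fps_mul f g) i.
Proof.
by move=> lt_in; rewrite (@coef_fps_mul n _ _ _ (fps_trunc n f) (fps_trunc n g))
  // => j /coef_fps_trunc ->.
Qed.

Fact fps_mulA : associative fps_mul.
Proof.
move=> f g h; apply: fpsP => k; have ltk := ltnSn k.
rewrite (coef_fps_mul ltk (@coef_fps_trunc _ f) (@coef_mul_trunc _ g h)).
by rewrite (coef_fps_mul ltk (@coef_mul_trunc _ f g) (@coef_fps_trunc _ h)) mulrA.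
Qed.

Fact fps_mulC : commutative fps_mul.
Proof.
move=> f g; apply: fpsP => k; have ltk := ltnSn k.
by rewrite -(coef_mul_trunc f g ltk) mulrC (coef_mul_trunc g f ltk).
Qed.

Fact fps_mul1 : left_id fps1 fps_mul.
Proof.
move=> f; apply: fpsP => k.
rewrite (@coef_fps_mul k.+1 _ _ _ 1 (fps_trunc k.+1 f)) //.
  by rewrite mul1r coef_fps_trunc.
by move=> i /coef_fps_trunc ->.
Qed.

Fact fps_mulDl : left_distributive fps_mul fps_add.
Proof.
move=> f g h; apply: fpsP => k /=; rewrite -big_split /=.
by apply: eq_bigr => i _; rewrite mulrDl.
Qed.

Fact fps_oner_neq0 : fps1 != 0.
Proof.
apply/eqP => /(congr1 (fun f => fps_coef f 0)) /= /eqP.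
by rewrite coef1 oner_eq0.
Qed.

HB.instance Definition _ := GRing.Zmodule_isComNzRing.Build (fps K)
  fps_mulA fps_mulC fps_mul1 fps_mulDl fps_oner_neq0.

Definition fps_unit : pred (fps K) := fun f => fps_coef f 0 != 0.

Fixpoint fps_inv_seq f n : seq K :=
  if n is n'.+1 then
    let s := fps_inv_seq f n' in
    rcons s ((fps_coef f 0)^-1 *
             ((n' == 0%N)%:R - \sum_(i < n') fps_coef f (n' - i) * s`_i))
  else [::].

Definition fps_inv f :=
  if fps_unit f then Fps (fun k => (fps_inv_seq f k.+1)`_k) else f.

Lemma size_fps_inv_seq f n : size (fps_inv_seq f n) = n.
Proof. by elim: n => //= n IHn; rewrite size_rcons IHn. Qed.

Lemma nth_fps_inv_seq f n k :
  (k < n)%N -> (fps_inv_seq f n)`_k = (fps_inv_seq f k.+1)`_k.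
Proof.
elim: n => // n IHn; rewrite ltnS leq_eqVlt => /orP[/eqP -> // | lt_kn].
by rewrite [fps_inv_seq f n.+1]/= nth_rcons size_fps_inv_seq lt_kn IHn.
Qed.

Fact fps_mulVf : {in fps_unit, left_inverse 1 fps_inv *%R}.
Proof.
move=> f Uf; have f0 : fps_coef f 0 != 0 := Uf; rewrite mulrC.
apply: fpsP => k; rewrite /fps_inv ifT //.
rewrite [LHS]/= (reindex_inj rev_ord_inj) /= big_ord_recr /= subSS subnn subn0.
rewrite nth_rcons size_fps_inv_seq ltnn eqxx mulVKf // coef1.
rewrite (eq_bigr (fun i : 'I_k => fps_coef f (k - i) * (fps_inv_seq f k)`_i)).
  by rewrite addrC subrK.
move=> i _; have lt_ik := ltn_ord i.
by rewrite subSS subKn 1?ltnW // (nth_fps_inv_seq f lt_ik).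
Qed.

Fact fps_unitPl f g : g * f = 1 -> fps_unit f.
Proof.
move=> /(congr1 (fun h => fps_coef h 0)) /=.
rewrite big_ord1 coef1 /= /fps_unit => gf1.
by apply: contraPneq gf1 => ->; rewrite mulr0 => /esym/eqP; rewrite oner_eq0.
Qed.

Fact fps_invr_out : {in [predC fps_unit], fps_inv =1 id}.
Proof. by move=> f nUf; rewrite /fps_inv ifN. Qed.

HB.instance Definition _ := GRing.ComNzRing_hasMulInverse.Build (fps K)
  fps_mulVf fps_unitPl fps_invr_out.

Definition fps_q : fps K := fps_of_poly 'X.

Definition fps_cvg (u : nat -> fps K) (f : fps K) : Prop :=
  forall k, exists n0, forall n, (n0 <= n)%N -> fps_coef (u n) k = fps_coef f k.

(* The junk value is 0 if the coefficients do not stabilise. *)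
Definition fps_lim (u : nat -> fps K) : fps K := xget 0 [set f | fps_cvg u f].

Lemma fps_cvg_unique u f g : fps_cvg u f -> fps_cvg u g -> f = g.
Proof.
move=> uf ug; apply: fpsP => k.
have [[n1 H1] [n2 H2]] := (uf k, ug k).
by rewrite -(H1 (maxn n1 n2)) ?leq_maxl // H2 ?leq_maxr.
Qed.

Lemma fps_cvg_lim u f : fps_cvg u f -> fps_lim u = f.
Proof.
move=> uf; rewrite /fps_lim; case: xgetP => [g -> ug | /(_ f)/(_ uf) //].
exact: fps_cvg_unique ug uf.
Qed.

End FpsRing.

Definition qpoch (R : comNzRingType) (a q : R) (k : nat) : R :=
  \prod_(i < k) (1 - a * q ^+ i).

Definition qpoch_inf (K : fieldType) (a q : fps K) : fps K :=
  fps_lim (qpoch a q).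

(* theta(q^a; q^b) = (q^a; q^b)_oo (q^b / q^a; q^b)_oo, for a <= b so that the
   argument q^(b - a) is a power series (beyond this range, [b - a] truncates
   to 0). *)
Definition theta_q (K : fieldType) (a b : nat) : fps K :=
  let q := fps_q K in
  qpoch_inf (q ^+ a) (q ^+ b) * qpoch_inf (q ^+ (b - a)) (q ^+ b).

(* A partition is a nonincreasing sequence of naturals, read as padded with
   infinitely many zeros. *)
Section HallLittlewood.
Variable lam : seq nat.

Definition partn_length : nat := count (fun p => 0 < p)%N lam.

(* m_i(lam) in N variables, i.e., counting N - l(lam) parts equal to 0. *)
Definition partn_mult (N i : nat) : nat :=
  if i == 0%N then (N - partn_length)%N else count_mem i lam.

(* The product is over all i >= 0; the factors with i > |lam| are 1. Stopping
   at i = N would break stability in N when N < lam_1. *)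
Definition hl_v (F : fieldType) (N : nat) (t : F) : F :=
  \prod_(i < (sumn lam).+1)
    (qpoch t t (partn_mult N i) / (1 - t) ^+ partn_mult N i).

Definition hl_summand (F : fieldType) (N : nat) (x : 'I_N -> F) (t : F) : F :=
  \prod_(i < N) x i ^+ nth 0%N lam i *
  \prod_(i < N) \prod_(j < N | (i < j)%N) ((x i - t * x j) / (x i - x j)).

Definition hl_symmetrization (F : fieldType) (N : nat) (x : 'I_N -> F) (t : F) :
    F :=
  (hl_v N t)^-1 * \sum_(w : 'S_N) hl_summand (fun i => x (w i)) t.

(* P_lam(x_1, ..., x_N; t), with coefficients in Q[t]: the unique polynomial
   whose image in the field of rational functions in x_1, ..., x_N and t is the
   symmetrization above, the polynomial variable of {poly rat} being t. *)
Definition hl_poly (N : nat) : {mpoly {poly rat}[N]} :=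
  if (partn_length <= N)%N then
    xget 0 [set P : {mpoly {poly rat}[N]} |
      tofrac P = hl_symmetrization (fun i => tofrac 'X_i)
                                   (tofrac (('X : {poly rat})%:MP_[N]))]
  else 0.

Definition hl_spec (n N : nat) : {poly rat} :=
  mmap (fun c : {poly rat} => c \Po 'X^n) (fun i : 'I_N => 'X^i) (hl_poly N).

(* P_lam(1, q, q^2, ...; q^n). A symmetric function f in infinitely many
   variables is the compatible family of the f(x_1, ..., x_N, 0, 0, ...), so
   its specialisation is the coefficientwise limit as N tends to infinity. *)
Definition hl_principal (n : nat) : fps rat :=
  fps_lim (fun N => fps_of_poly (hl_spec n N)).

End HallLittlewood.

Definition theta_product (n kappa : nat) : fps rat :=
  let q := fps_q rat in
  qpoch_inf (q ^+ kappa) (q ^+ kappa) ^+ (n - 1) / qpoch_inf q q ^+ n *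
  \prod_(1 <= i < n.+1) \prod_(i.+1 <= j < n.+1) theta_q rat (j - i) kappa.

(* Main.v *)
From HB Require Import structures.
Require Import Defs.
From mathcomp Require Import all_boot all_order all_algebra all_fingroup.
From mathcomp Require Import boolp mpoly ring zify.

Set Implicit Arguments.
Unset Strict Implicit.
Unset Printing Implicit Defensive.

Import GRing.Theory.
Local Open Scope ring_scope.

(** Substituting t = q^n and x_i = q^(i-1) in the symmetrisation of (m^r), written as
a sum over the r-subsets I of the variables, kills every I that is not closed under
i |-> i - n; so I is given by the lengths k_0, ..., k_(n-1) (of sum r) of its
intersections with the n residue classes, and the products over j outside I telescope.
The same happens for the partition (0^r) with t = q^kappa and the n strings
c + kappa N, 0 <= c < n, but there the sum is known: it is 1/(q^kappa; q^kappa)_r.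

In both cases the k-th term is Num(k) / Den(k), where Den(k) tends to an infinite
product as min k grows, and expanding a Vandermonde determinant gives
Num(k) = +- sum_w sgn(w) q^E(k, w). The quadratic exponents of the two cases satisfy
E(k, w) = m C(r, 2) + E'(k o w, w^-1), so that both sums of numerators agree exactly.
Since Num(k) is divisible by a high power of q when min k is small compared with r,
the limit is 1/(q^kappa; q^kappa)_oo times the quotient of the two infinite products;
comparing the two sums thus replaces the Macdonald identity for A_(n-1). The level-rank symmetry of the answer is a
count of exponents of the (q^s; q^kappa)_oo. *)

(** * Subset form of the Hall-Littlewood polynomial of a rectangle *)

(** Why the comparison uses the modulus m + n: for strings of modulus beta and factors x_i^l, with r
    and w fixed, the exponent is, up to a term independent of k, (l + n) sum c k_c + beta sum c k_(w
    c) + (beta (l + n) / 2) sum k_c^2. Passing from (beta, l) = (n, m) to (m + n, 0) keeps the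
    product beta (l + n) and exchanges the two linear coefficients; passing from k, w to k o w, w^-1
    exchanges the two linear forms. The common sum of numerators is never evaluated, only eliminated
    between two congruences. Two obstacles shape the rest. A single term has denominators q^a - q^b
    that are not invertible power series, so the sums live in [{fraction (fps rat)}], and the
    replacement of Den(k) by its limit has to be controlled q-adically and uniformly over all
    compositions of r, including those with a short string. Moreover [hl_poly] is picked by [xget],
    so it has a meaning only once the symmetrisation is known to be a polynomial; this is why a
    numerator is shown to be divisible by the Vandermonde product. *)

Section SubsetSums.
Variables (K : fieldType) (T : finType) (x : T -> K) (t : K).
Hypotheses (x_inj : injective x) (x_neq0 : forall a, x a != 0) (t_neq1 : t != 1).
Implicit Types (A I : {set T}) (a b : T) (m r : nat).

Definition hl_ratio a b : K := (x a - t * x b) / (x a - x b).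

Definition hl_subset_term A m I : K :=
  \prod_(i in I) x i ^+ m * \prod_(i in I) \prod_(j in A :\: I) hl_ratio i j.

Definition hl_subset_sum A r m : K :=
  \sum_(I : {set T} | (I \subset A) && (#|I| == r)) hl_subset_term A m I.

Lemma subx_neq0 a b : a != b -> x a - x b != 0.
Proof. by move=> ab; rewrite subr_eq0 (inj_eq x_inj). Qed.

(* Lagrange interpolation of prod_b (z - t x_b) - prod_b (z - x_b), which has
   degree < #|A|, at the nodes x_a, evaluated at z = 0. *)
Lemma sum_prod_hl_ratio A :
  \sum_(a in A) \prod_(b in A :\ a) hl_ratio a b = (1 - t ^+ #|A|) / (1 - t).
Proof.
have t1 : 1 - t != 0 by rewrite subr_eq0 eq_sym.
pose f : {poly K} := \prod_(b in A) ('X - (t * x b)%:P) - \prod_(b in A) ('X - (x b)%:P).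
pose l a : {poly K} := \prod_(b in A :\ a) ((x a - x b)^-1 *: ('X - (x b)%:P)).
have fx a : a \in A -> f.[x a] = (1 - t) * x a * \prod_(b in A :\ a) (x a - t * x b).
  move=> aA; rewrite hornerD hornerN !horner_prod [X in _ - X](big_setD1 a) //=.
  rewrite hornerXsubC subrr mul0r subr0 (big_setD1 a) //= !hornerXsubC.
  by congr (_ * _); [ring | apply: eq_bigr => b _; rewrite hornerXsubC].
have lx a c : a \in A -> c \in A -> (l a).[x c] = (a == c)%:R.
  move=> aA cA; rewrite horner_prod; case: eqVneq => [<-|ac].
    apply: big1 => b; rewrite !inE => /andP[ba _].
    by rewrite hornerZ hornerXsubC mulVf // subx_neq0 // eq_sym.
  rewrite (big_setD1 c) ?inE 1?eq_sym ?ac //=.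
  by rewrite hornerZ hornerXsubC subrr mulr0 mul0r.
have size_prod_lin (g : T -> K) (D : {set T}) : size (\prod_(b in D) ('X - (g b)%:P)) =
  #|D|.+1.
  by rewrite -big_enum size_prod_XsubC -cardE.
have szf : (size f <= #|A|)%N.
  rewrite -ltnS -(size_prod_lin (fun b => t * x b)).
  apply: (leq_ltn_trans _ (_ : (#|A| < _)%N)); last by rewrite size_prod_lin.
  apply/leq_sizeP => j; rewrite leq_eqVlt => /orP[/eqP <-|ltj].
    have := monicP (monic_prod_XsubC (enum A) xpredT (fun b => t * x b)).
    have := monicP (monic_prod_XsubC (enum A) xpredT x).
    rewrite !big_enum /lead_coef !size_prod_lin /= coefB => -> ->.
    by rewrite subrr.
  by rewrite coefB !nth_default ?subrr // size_prod_lin.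
have szl a : a \in A -> (size (l a) <= #|A|)%N.
  move=> aA; rewrite /l scaler_prod; apply: leq_trans (size_scale_leq _ _) _.
  by rewrite size_prod_lin (cardsD1 a A) aA.
pose h := \sum_(a in A) f.[x a] *: l a.
have fh : f = h.
  apply/eqP; rewrite -subr_eq0; apply/eqP.
  apply: (@roots_geq_poly_eq0 _ _ [seq x a | a in A]).
  - apply/allP => _ /mapP[c + ->]; rewrite mem_enum => cA.
    rewrite /root hornerD hornerN /h horner_sum (big_setD1 c) //= hornerZ lx // eqxx.
    rewrite mulr1 big1 ?addr0 ?subrr // => a; rewrite !inE => /andP[ac aA].
    by rewrite hornerZ lx // (negPf ac) mulr0.
  - by rewrite map_inj_uniq // enum_uniq.
  - rewrite size_map -cardE; apply: leq_trans (size_polyD _ _) _.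
    rewrite geq_max szf size_polyN /=; apply: leq_trans (size_sum _ _ _) _.
    by apply/bigmax_leqP => a aA; apply: leq_trans (size_scale_leq _ _) (szl _ aA).
have f0 : f.[0] = (- 1) ^+ #|A| * (t ^+ #|A| - 1) * \prod_(b in A) x b.
  rewrite hornerD hornerN !horner_prod.
  under eq_bigr do rewrite hornerXsubC sub0r -mulN1r mulrA.
  rewrite big_split /= prodr_const.
  under [X in _ - X]eq_bigr do rewrite hornerXsubC sub0r -mulN1r.
  rewrite big_split /= !prodr_const exprMn; ring.
have h0 : h.[0] = - (-1) ^+ #|A| * (1 - t) * (\prod_(b in A) x b) *
    \sum_(a in A) \prod_(b in A :\ a) hl_ratio a b.
  rewrite /h horner_sum mulr_sumr; apply: eq_bigr => a aA.
  rewrite hornerZ fx // horner_prod.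
  under [X in _ * X = _]eq_bigr do rewrite hornerZ hornerXsubC sub0r mulrN -mulN1r.
  rewrite !big_split /= prodr_const (big_setD1 a aA) /= (cardsD1 a A) aA /= exprS.
  rewrite prodfV; ring.
have : h.[0] = f.[0] by rewrite fh.
rewrite h0 f0 => e.
have pn : \prod_(b in A) x b != 0 by apply/prodf_neq0 => b _.
have sn : (-1 : K) ^+ #|A| != 0 by rewrite expf_neq0 // oppr_eq0 oner_eq0.
apply: (mulfI sn); apply: (mulfI pn); apply: (mulfI t1).
apply: (@oppr_inj K); transitivity (- (-1) ^+ #|A| * (1 - t) * (\prod_(b in A) x b) *
    \sum_(a in A) \prod_(b in A :\ a) hl_ratio a b); first by ring.
by rewrite e; field.
Qed.

(** Double counting of sets I with r + 1 elements and a marked a in I. The term of I minus a, times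
    all ratios out of a, is the term of I times the ratios from a to the rest of I; summed over a in
    I, the latter give the constant of [sum_prod_hl_ratio]. *)
Lemma hl_subset_sum_rec A r m :
  \sum_(a in A) x a ^+ m * \prod_(b in A :\ a) hl_ratio a b * hl_subset_sum (A :\ a) r m =
  (1 - t ^+ r.+1) / (1 - t) * hl_subset_sum A r.+1 m.
Proof.
transitivity (\sum_(a in A) \sum_(I : {set T} | [&& I \subset A, #|I| == r.+1 & a \in I])
    (\prod_(b in I :\ a) hl_ratio a b) * hl_subset_term A m I).
  apply: eq_bigr => a aA; rewrite /hl_subset_sum mulr_sumr.
  rewrite (reindex_onto (fun I => I :\ a) (fun I => a |: I)) /=; last first.
    by move=> I /andP[/subsetD1P[_ aI] _]; rewrite setU1K.
  apply: eq_big => [I|I].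
    apply/idP/idP => [/andP[/andP[sIA cI] /eqP eI]|/and3P[sIA cI aI]].
      have aI : a \in I by rewrite -eI setU11.
      rewrite aI andbT (cardsD1 a I) aI (eqP cI) eqxx andbT -eI subUset sub1set aA.
      by apply: subset_trans sIA _; rewrite subD1set.
    rewrite setSD // setD1K // eqxx andbT /=.
    by move: cI; rewrite (cardsD1 a I) aI.
  move=> /andP[/andP[sIA cI] /eqP eI].
  have aI : a \in I by rewrite -eI setU11.
  have sI : I \subset A by rewrite -eI subUset sub1set aA (subset_trans sIA) ?subD1set.
  have -> : hl_subset_term A m I =
     x a ^+ m * \prod_(i in I :\ a) x i ^+ m *
     (\prod_(j in A :\: I) hl_ratio a j * \prod_(i in I :\ a) \prod_(j in A :\: I) hl_ratio
       i j).
    by rewrite /hl_subset_term !(big_setD1 a aI).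
  rewrite /hl_subset_term.
  have -> : A :\ a :\: (I :\ a) = A :\: I.
    by apply/setP => b; rewrite !inE; case: eqVneq => [->|_]; rewrite ?aI //.
  rewrite -/(A :\ a) (big_setID I) /=.
  have -> : (A :\ a) :&: I = I :\ a.
    apply/setP => b; rewrite !inE; case: eqVneq => //= _.
    by apply/andP/idP => [[]//|bI]; split=> //; apply: (subsetP sI).
  have -> : A :\ a :\: I = A :\: I.
    by apply/setP => b; rewrite !inE; case: eqVneq => [->|_]; rewrite ?aI //.
  ring.
rewrite (exchange_big_dep (fun I : {set T} => (I \subset A) && (#|I| == r.+1))) /=;
  last first.
  by move=> a I _ /and3P[-> ->].
rewrite /hl_subset_sum mulr_sumr; apply: eq_bigr => I /andP[sIA cI].
rewrite -mulr_suml -(eqP cI) -sum_prod_hl_ratio; congr (_ * _).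
apply: eq_bigl => a; rewrite sIA eqxx /=.
by apply/andP/idP => [[]//|aI]; split=> //; apply: (subsetP sIA).
Qed.

Lemma hl_subset_sum0 A m : hl_subset_sum A 0 m = 1.
Proof.
rewrite /hl_subset_sum (big_pred1 set0); last first.
  by move=> I /=; rewrite cards_eq0; case: eqVneq => [->|]; rewrite ?sub0set ?andbF.
by rewrite /hl_subset_term !big_set0 mulr1.
Qed.

(** The t-factorial [k]_t!, the contribution to v_lambda of a part of multiplicity k. *)
Definition hl_vfact k : K := qpoch t t k / (1 - t) ^+ k.

Lemma hl_vfactS k : hl_vfact k.+1 = hl_vfact k * ((1 - t ^+ k.+1) / (1 - t)).
Proof. by rewrite /hl_vfact /qpoch big_ord_recr /= -exprS [(1 - t) ^+ k.+1]exprS invfM;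
  ring. Qed.

End SubsetSums.

Lemma prod_ord_gt0S (R : comNzRingType) N (F : 'I_N.+1 -> 'I_N.+1 -> R) :
  \prod_(i < N.+1) \prod_(j < N.+1 | (i < j)%N) F i j =
  \prod_j F ord0 (lift ord0 j) *
  \prod_(i < N) \prod_(j < N | (i < j)%N) F (lift ord0 i) (lift ord0 j).
Proof.
rewrite big_ord_recl; congr (_ * _).
  by rewrite big_mkcond big_ord_recl /= mul1r; apply: eq_bigr.
apply: eq_bigr => i _; rewrite big_mkcond big_ord_recl /= mul1r [RHS]big_mkcond.
by apply: eq_bigr => j _.
Qed.

(** Permutations are grouped by a = w(0), the variable that receives the first part; what remains
    permutes the other N variables. *)
Lemma hl_symmetrizationS (K : fieldType) (lam : seq nat) N (x : 'I_N.+1 -> K) (t : K) :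
  \sum_(w : 'S_N.+1) hl_summand lam (fun i => x (w i)) t =
  \sum_a x a ^+ nth 0%N lam 0 *
    (\prod_j ((x a - t * x (lift a j)) / (x a - x (lift a j)))) *
    \sum_(w : 'S_N) hl_summand (behead lam) (fun i => x (lift a (w i))) t.
Proof.
rewrite (partition_big (fun w : 'S_N.+1 => w ord0) xpredT) //=.
apply: eq_bigr => a _; rewrite (reindex (lift_perm ord0 a)); last first.
  (* [ulsf i s] is s with the argument i and the value s i deleted; it inverts [lift_perm]. *)
  pose ulsf i (s : 'S_N.+1) k := odflt k (unlift (s i) (s (lift i k))).
  have ulsfK i (s : 'S_N.+1) k : lift (s i) (ulsf i s k) = s (lift i k).
    rewrite /ulsf; have:= neq_lift i k.
    by rewrite -(can_eq (permK s)) => /unlift_some[] ? ? ->.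
  have inj_ulsf : injective (ulsf ord0 _).
    move=> s; apply: can_inj (ulsf (s ord0) s^-1%g) _ => k'.
    by rewrite {1}/ulsf ulsfK !permK liftK.
  exists (fun s => perm (inj_ulsf s)) => [s _ | s].
    apply/permP=> k'; rewrite permE /ulsf lift_perm_lift lift_perm_id.
    by rewrite liftK.
  move/(s _ =P _) => si0; apply/permP=> k.
  case: (unliftP ord0 k) => [k'|] ->; rewrite ?lift_perm_id //.
  by rewrite lift_perm_lift -si0 permE ulsfK.
rewrite mulr_sumr; apply: eq_big => [w|w _]; first by rewrite lift_perm_id eqxx.
rewrite /hl_summand big_ord_recl prod_ord_gt0S lift_perm_id /=.
set P0 := \prod_(i < N) _ ^+ _; set P1 := \prod_(i < N) (_ / _).
set P2 := \prod_(i < N) \prod_(j < N | _) _.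
have -> : P0 = \prod_(i < N) x (lift a (w i)) ^+ nth 0%N (behead lam) i.
  by apply: eq_bigr => i _; rewrite lift_perm_lift nth_behead.
have -> : P1 = \prod_j ((x a - t * x (lift a j)) / (x a - x (lift a j))).
  rewrite [RHS](reindex_inj (@perm_inj _ w)).
  by apply: eq_bigr => i _; rewrite lift_perm_lift.
have -> : P2 = \prod_(i < N) \prod_(j < N | (i < j)%N)
    ((x (lift a (w i)) - t * x (lift a (w j))) / (x (lift a (w i)) - x (lift a (w j)))).
  by apply: eq_bigr => i _; apply: eq_bigr => j _; rewrite !lift_perm_lift.
ring.
Qed.

Lemma imset_lift (T : finType) N (f : 'I_N.+1 -> T) (a : 'I_N.+1) : injective f ->
  (fun j => f (lift a j)) @: setT = (f @: setT) :\ f a.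
Proof.
move=> f_inj; apply/setP => b; rewrite !inE; apply/imsetP/andP => [[j _ ->]|].
  by rewrite (inj_eq f_inj) eq_sym neq_lift imset_f.
case=> ba /imsetP[i _ bi]; move: ba; rewrite bi (inj_eq f_inj) => ia.
rewrite eq_sym in ia; have [j -> _] := unlift_some ia; by exists j.
Qed.

Section Rectangle.
Variables (K : fieldType) (T : finType) (x : T -> K) (t : K).
Hypotheses (x_inj : injective x) (x_neq0 : forall a, x a != 0) (t_neq1 : t != 1).

(** Induction on N: the value w(0) is split off, and the sum over it is [hl_subset_sum_rec], or
    [sum_prod_hl_ratio] when r = 0. The variables are reached through an injection [f] into a fixed
    type, so that deleting one changes [f] but not the type. *)
Lemma hl_symmetrization_rect N r m (f : 'I_N -> T) : injective f -> (r <= N)%N ->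
  \sum_(w : 'S_N) hl_summand (nseq r m) (fun i => x (f (w i))) t =
  hl_vfact t r * hl_vfact t (N - r) * hl_subset_sum x t (f @: setT) r m.
Proof.
have v0 : hl_vfact t 0 = 1 by rewrite /hl_vfact /qpoch big_ord0 expr0 divr1.
elim: N r f => [|N IHN] r f f_inj.
  rewrite leqn0 => /eqP ->; rewrite hl_subset_sum0 v0 !mulr1.
  under eq_bigr do rewrite /hl_summand !big_ord0 mulr1.
  by rewrite sumr_const -[RHS](mulr1n) /=; congr (_ *+ _); rewrite card_Sn.
move=> le_rN.
have fl_inj a : injective (fun j => f (lift a j)) by move=> i j /f_inj /lift_inj.
rewrite (hl_symmetrizationS _ (fun i => x (f i))).
have ratio a : \prod_j ((x (f a) - t * x (f (lift a j))) / (x (f a) - x (f (lift a j)))) =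
    \prod_(b in (f @: setT) :\ f a) hl_ratio x t (f a) b.
  rewrite -imset_lift // big_imset /=; last by move=> i j _ _ /fl_inj.
  by apply: eq_big => // i; rewrite inE.
have sumf (g : T -> K) : \sum_a g (f a) = \sum_(b in f @: setT) g b.
  rewrite big_imset /=; last by move=> i j _ _ /f_inj.
  by apply: eq_bigl => i; rewrite inE.
case: r le_rN => [|r] le_rN.
  rewrite hl_subset_sum0 v0 subn0 mulr1 mul1r hl_vfactS.
  transitivity (\sum_a (\prod_(b in (f @: setT) :\ f a) hl_ratio x t (f a) b) * hl_vfact t
    N).
    apply: eq_bigr => a _; rewrite -[behead _]/(nseq 0 m) (IHN 0%N (fun j => f (lift a j)))
      // ratio hl_subset_sum0 v0 subn0; ring.
  rewrite -mulr_suml (sumf (fun b => \prod_(c in _ :\ b) hl_ratio x t b c)).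
  by rewrite sum_prod_hl_ratio // card_imset // cardsT card_ord mulrC.
transitivity (\sum_a x (f a) ^+ m * (\prod_(b in (f @: setT) :\ f a) hl_ratio x t (f a) b) *
   hl_subset_sum x t ((f @: setT) :\ f a) r m * (hl_vfact t r * hl_vfact t (N - r))).
  apply: eq_bigr => a _; rewrite -[behead _]/(nseq r m) (IHN r (fun j => f (lift a j))) //
    ratio imset_lift //=; ring.
rewrite -mulr_suml.
rewrite (sumf (fun b => x b ^+ m * (\prod_(c in _ :\ b) hl_ratio x t b c) * hl_subset_sum x
  t (_ :\ b) r m)).
by rewrite hl_subset_sum_rec // subSS hl_vfactS; ring.
Qed.

Lemma hl_v_rect N r m : (0 < m)%N ->
  hl_v (nseq r m) N t = hl_vfact t r * hl_vfact t (N - r).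
Proof.
move=> m0.
have v0 : hl_vfact t 0 = 1 by rewrite /hl_vfact /qpoch big_ord0 expr0 divr1.
have len : partn_length (nseq r m) = r by rewrite /partn_length count_nseq m0 mul1n.
rewrite /hl_v big_ord_recl /partn_mult /= len mulrC; congr (_ * _).
have mult i : count_mem i.+1 (nseq r m) = (if i.+1 == m then r else 0)%N.
  by rewrite count_nseq /= eq_sym; case: (i.+1 == m); rewrite ?mul1n.
case: (posnP r) => [->|r_gt0]; first by rewrite big_ord0 v0.
(* For r > 0 the factor of the part m is within range because m <= r m; its index is m - 1 since the
   factor of the part 0 has been split off. *)
have m_lt : (m.-1 < sumn (nseq r m))%N by rewrite sumn_nseq; nia.
rewrite (bigD1 (Ordinal m_lt)) //= /bump /= !add1n mult prednK // eqxx.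
rewrite big1 ?mulr1 // => i im; rewrite !add1n mult.
rewrite ifF -/(hl_vfact t 0) //; apply: contraNF im => /eqP e.
by apply/eqP/val_inj => /=; lia.
Qed.

(** (0^r) is the empty partition padded with zeros, so the symmetrisation does not depend on r and
    can be read off at r = 0. The subset sum is thus a t-binomial coefficient. *)
Lemma hl_subset_sum_m0 N r (f : 'I_N -> T) : injective f -> (r <= N)%N ->
  hl_vfact t r * hl_vfact t (N - r) * hl_subset_sum x t (f @: setT) r 0 = hl_vfact t N.
Proof.
move=> f_inj le_rN; rewrite -hl_symmetrization_rect //.
have -> : hl_vfact t N = hl_vfact t 0 * hl_vfact t (N - 0) * hl_subset_sum x t (f @: setT)
  0 0.
  by rewrite hl_subset_sum0 subn0 {2}/hl_vfact /qpoch big_ord0 expr0 divr1; ring.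
rewrite -hl_symmetrization_rect //; apply: eq_bigr => w _.
by rewrite /hl_summand; congr (_ * _); apply: eq_bigr => i _;
  rewrite nth_nseq if_same nth_nil.
Qed.

Lemma hl_symmetrization_subset_sum N r m (f : 'I_N -> T) : injective f -> (r <= N)%N ->
  (0 < m)%N -> (forall k, hl_vfact t k != 0) ->
  hl_symmetrization (nseq r m) (fun i => x (f i)) t = hl_subset_sum x t (f @: setT) r m.
Proof.
move=> f_inj le_rN m0 v_neq0; rewrite /hl_symmetrization hl_v_rect //.
by rewrite (hl_symmetrization_rect m f_inj le_rN) mulrA mulVf ?mul1r // mulf_neq0.
Qed.

End Rectangle.

(** * Specialisation to geometric strings *)

Lemma card_ord_lt M k : (k <= M)%N -> #|[set a : 'I_M | (a < k)%N]| = k.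
Proof.
move=> kM; rewrite -sum1_card (eq_bigl (fun a : 'I_M => (a < k)%N)); last first.
  by move=> a; rewrite inE.
by rewrite -(big_ord_widen M (fun=> 1%N) kM) sum1_card card_ord.
Qed.

Lemma initial_segment_mem M (S : {set 'I_M}) :
  (forall a b : 'I_M, b.+1 = a -> a \in S -> b \in S) ->
  forall a : 'I_M, (a \in S) = (a < #|S|)%N.
Proof.
move=> S_pred.
have S_down : forall e (a b : 'I_M), (b + e)%N = a -> a \in S -> b \in S.
  elim=> [|e IHe] a b; first by rewrite addn0 => /val_inj ->.
  move=> ba aS; have ltM : (b.+1 < M)%N by have := ltn_ord a; lia.
  by apply: (S_pred (Ordinal ltM)) => //; apply: (IHe a); rewrite //= addSnnS.
move=> a; apply/idP/idP => [aS|].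
  rewrite -(card_ord_lt (ltn_ord a)); apply/subset_leq_card/subsetP => b.
  by rewrite inE ltnS => ba; apply: (S_down (a - b)%N a); rewrite // subnKC.
apply: contraLR => aS; rewrite -leqNgt -(card_ord_lt (ltnW (ltn_ord a))).
apply/subset_leq_card/subsetP => b bS; rewrite inE ltnNge; apply: contra aS => ab.
by apply: (S_down (b - a)%N b); rewrite // subnKC.
Qed.

Lemma big_in_pair (R : Type) (idx : R) (op : Monoid.com_law idx) (U V : finType)
    (I : {set U * V}) (F : U -> V -> R) :
  \big[op/idx]_(p in I) F p.1 p.2 = \big[op/idx]_c \big[op/idx]_(a | (c, a) \in I) F c a.
Proof. by rewrite pair_big_dep; apply: eq_bigl => -[]. Qed.

Lemma telescope_prod_ratio (K : fieldType) (f : nat -> K) k B : (k <= B)%N ->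
  (forall b, (k <= b)%N -> f b != 0) -> \prod_(k <= b < B) (f b.+1 / f b) = f B / f k.
Proof.
move=> kB f_neq0; rewrite -(subnKC kB); elim: (B - k)%N => [|e IHe].
  by rewrite addn0 big_geq // divff // f_neq0.
by rewrite addnS big_nat_recr ?leq_addr //= IHe mulrC mulrA divfK // f_neq0 ?leq_addr.
Qed.

Section Strings.
Variables (K : fieldType) (q : K) (n beta : nat).
Hypotheses (q_neq0 : q != 0) (q_expn_neq1 : forall i, (0 < i)%N -> q ^+ i != 1).
Hypothesis (le_n_beta : (n <= beta)%N).

Lemma q_expn_inj : injective (fun i => q ^+ i).
Proof.
suff w i j : (i <= j)%N -> q ^+ i = q ^+ j -> i = j.
  by move=> i j /= e; case: (leqP i j) => [/w -> // | /ltnW /w -> //].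
rewrite leq_eqVlt => /orP[/eqP //|ij] e; have := @q_expn_neq1 (j - i)%N.
rewrite subn_gt0 ij => /(_ isT) /eqP []; apply: (@mulfI _ (q ^+ i)); first exact: expf_neq0.
by rewrite -exprD subnKC 1?ltnW // mulr1.
Qed.

(** Serves both cases: for beta = n the strings fill the natural numbers, for beta = m + n they meet
    only the first n residue classes. *)
Definition string_pt (c : 'I_n) (a : nat) : nat := (c + beta * a)%N.

Lemma string_pt_inj (c d : 'I_n) a b : string_pt c a = string_pt d b -> c = d /\ a = b.
Proof.
clear q_neq0 q_expn_neq1; rewrite /string_pt => e; have [lc ld] := (ltn_ord c, ltn_ord d).
have ab : a = b.
  have := congr1 (fun z => z %/ beta)%N e; rewrite ![(_ + beta * _)%N]addnC ![(beta *
    _)%N]mulnC.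
  by rewrite !divnMDl ?divn_small ?addn0 //; lia.
by split=> //; apply: val_inj; move: e; rewrite ab => /addIn.
Qed.

Definition string_val M (p : 'I_n * 'I_M) : K := q ^+ string_pt p.1 p.2.

Lemma string_val_inj M : injective (@string_val M).
Proof. by move=> [c a] [d b] /q_expn_inj /string_pt_inj /= [-> /val_inj ->]. Qed.

Lemma string_val_neq0 M (p : 'I_n * 'I_M) : string_val p != 0.
Proof. exact: expf_neq0. Qed.

Lemma string_sub_neq0 (c d : 'I_n) a b : (c, a) != (d, b) ->
  q ^+ string_pt c a - q ^+ string_pt d b != 0.
Proof.
by move=> ne; rewrite subr_eq0 (inj_eq q_expn_inj); apply: contraNN ne => /eqP
  /string_pt_inj [-> ->].
Qed.

Definition compositions r : pred {ffun 'I_n -> 'I_r.+1} :=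
  fun k => (\sum_c k c)%N == r.

Section Lengths.
Variables (M r m : nat) (B : 'I_n -> nat).
Hypothesis (B_le : forall c, (B c <= M)%N).

Local Notation T := ('I_n * 'I_M)%type.
Local Notation A := [set p : T | (p.2 < B p.1)%N].
Local Notation x := (@string_val M).
Implicit Types (I : {set T}).

(** [M] only makes the index type finite. The alphabet is [A], whose strings may have unequal
    lengths [B c], as n need not divide the number of variables. *)
Definition string_seg (k : 'I_n -> nat) : {set T} := [set p : T | (p.2 < k p.1)%N].

Definition string_cnt (I : {set T}) (c : 'I_n) : nat := #|[set a | (c, a) \in I]|.

Definition string_closed (I : {set T}) : bool :=
  [forall c : 'I_n, forall a : 'I_M, forall b : 'I_M, (b.+1 == a) ==> ((c, a) \in I) ==>
    ((c, b) \in I)].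

Lemma string_closedP I : string_closed I -> string_seg (string_cnt I) = I.
Proof.
move=> cl; apply/setP => -[c a]; rewrite inE /= /string_cnt.
rewrite -(@initial_segment_mem M [set a | (c, a) \in I]) ?inE // => a1 b1 /eqP ba.
rewrite !inE; move/forallP/(_ c)/forallP/(_ a1)/forallP/(_ b1): cl.
by rewrite ba /= => /implyP.
Qed.

Lemma string_segK (k : 'I_n -> nat) : (forall c, k c <= M)%N -> string_cnt (string_seg k)
  =1 k.
Proof.
move=> kM c; rewrite /string_cnt -[RHS](card_ord_lt (kM c)).
by apply: eq_card => a; rewrite !inE.
Qed.

Lemma sum_string_cnt I : (\sum_c string_cnt I c)%N = #|I|.
Proof.
rewrite -sum1_card (big_in_pair _ _ (fun _ _ => 1%N)); apply: eq_bigr => c _.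
by rewrite sum1_card; apply: eq_card => a; rewrite !inE.
Qed.

(** If I contains (c, b + 1) but not (c, b), the ratio of these two points has numerator x_(c, b +
    1) - q^beta x_(c, b) = 0. *)
Lemma hl_subset_term_not_closed I : I \subset A -> ~~ string_closed I ->
  hl_subset_term x (q ^+ beta) A m I = 0.
Proof.
move=> IA /forallPn[c /forallPn[a /forallPn[b]]].
rewrite !negb_imply => /andP[/eqP ba /andP[aI bI]].
have bA : (c, b) \in A.
  by move/subsetP/(_ _ aI): IA; rewrite !inE /= => /(leq_trans _) -> //; rewrite -ba.
rewrite /hl_subset_term [X in _ * X](bigD1 (c, a)) //= [X in _ * (X * _)](bigD1 (c, b)) /=;
  last first.
  by rewrite !inE bI /=; move: bA; rewrite inE.
rewrite [X in _ * (X * _ * _)](_ : _ = 0) ?mul0r ?mulr0 //.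
rewrite /hl_ratio /string_val /string_pt /= -exprD -ba.
by rewrite (_ : beta + (c + beta * b) = c + beta * b.+1)%N ?subrr ?mul0r //; lia.
Qed.

Lemma prod_string_seg (k : 'I_n -> nat) (F : 'I_n -> nat -> K) : (forall c, k c <= M)%N ->
  \prod_(p in string_seg k) F p.1 p.2 = \prod_c \prod_(a < k c) F c a.
Proof.
move=> kM; rewrite (big_in_pair _ _ (fun c (a : 'I_M) => F c a)).
apply: eq_bigr => c _; rewrite (big_ord_widen M) //.
by apply: eq_bigl => a; rewrite inE.
Qed.

Lemma prod_string_diff (k : 'I_n -> nat) (F : 'I_n -> nat -> K) :
  \prod_(p in A :\: string_seg k) F p.1 p.2 = \prod_c \prod_(k c <= a < B c) F c a.
Proof.
rewrite (big_in_pair _ _ (fun c (a : 'I_M) => F c a)).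
apply: eq_bigr => c _; rewrite big_geq_mkord /=.
rewrite (big_ord_widen_cond M (fun a => k c <= a)%N) //.
by apply: eq_bigl => a; rewrite !inE /= -leqNgt.
Qed.

Definition string_term (k : 'I_n -> nat) : K :=
  \prod_c \prod_(a < k c) (q ^+ string_pt c a ^+ m *
    \prod_d ((q ^+ string_pt c a - q ^+ string_pt d (B d)) /
             (q ^+ string_pt c a - q ^+ string_pt d (k d)))).

(** Multiplication by t = q^beta moves one step up a string, so the ratios to the points of string d
    outside I telescope from b = k d to b = B d. *)
Lemma hl_subset_term_string (k : 'I_n -> nat) : (forall c, k c <= B c)%N ->
  hl_subset_term x (q ^+ beta) A m (string_seg k) = string_term k.
Proof.
move=> kB; have kM c : (k c <= M)%N := leq_trans (kB c) (B_le c).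
rewrite /hl_subset_term /string_term.
rewrite (prod_string_seg (fun c a => q ^+ string_pt c a ^+ m)) //.
rewrite (eq_bigr (fun p : T => \prod_d ((q ^+ string_pt p.1 p.2 - q ^+ string_pt d (B d)) /
             (q ^+ string_pt p.1 p.2 - q ^+ string_pt d (k d))))); last first.
  move=> [c a]; rewrite inE /= => ak.
  rewrite (eq_bigr (fun p : T => (q ^+ string_pt c a - q ^+ string_pt p.1 p.2.+1) /
     (q ^+ string_pt c a - q ^+ string_pt p.1 p.2))); last first.
    move=> [d b] _; rewrite /hl_ratio /string_val /= -exprD.
    by rewrite (_ : beta + string_pt d b = string_pt d b.+1)%N // /string_pt; lia.
  rewrite (prod_string_diff k (fun d b => (q ^+ string_pt c a - q ^+ string_pt d b.+1) /
     (q ^+ string_pt c a - q ^+ string_pt d b))).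
  apply: eq_bigr => d _.
  rewrite (telescope_prod_ratio (f := fun b => q ^+ string_pt c a - q ^+ string_pt d b)) //.
  move=> b kb; apply: string_sub_neq0; apply/eqP => -[cd ab].
  by move: ak kb; rewrite cd ab; lia.
rewrite (prod_string_seg (fun c a => \prod_d ((q ^+ string_pt c a - q ^+ string_pt d (B d))
  /
             (q ^+ string_pt c a - q ^+ string_pt d (k d))))) //.
by rewrite -big_split /=; apply: eq_bigr => c _; rewrite big_split.
Qed.

(** The numerator at a = B c and d = c vanishes. Compositions too long for the alphabet may
    therefore be kept, and the index set of the sum is the same for all [B]. *)
Lemma string_term_eq0 (k : 'I_n -> nat) c : (B c < k c)%N -> string_term k = 0.
Proof.
move=> Bk; rewrite /string_term (bigD1 c) //= (bigD1 (Ordinal Bk)) //= (bigD1 c) //=.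
by rewrite subrr !mul0r mulr0 !mul0r.
Qed.

Lemma hl_subset_sum_string :
  hl_subset_sum x (q ^+ beta) A r m = \sum_(k | @compositions r k) string_term (fun c => k
    c).
Proof.
rewrite /hl_subset_sum (bigID string_closed) /= [X in _ + X]big1 ?addr0; last first.
  by move=> I /andP[/andP[IA _] /(hl_subset_term_not_closed IA)].
rewrite [RHS](bigID (fun k : {ffun 'I_n -> 'I_r.+1} => [forall c, k c <= B c]%N)) /=.
rewrite [X in _ = _ + X]big1 ?addr0; last first.
  by move=> k /andP[_ /forallPn[c]]; rewrite -ltnNge => Bk; apply: (@string_term_eq0 _ c).
(* A closed set of r elements is recovered from its string lengths; [inord] loses nothing, because
   no length exceeds r. *)
rewrite (reindex_onto (fun k : {ffun 'I_n -> 'I_r.+1} => string_seg (fun c => k c))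
  (fun I => [ffun c => inord (string_cnt I c)])) /=; last first.
  move=> I /andP[/andP[_ /eqP cI] clI]; rewrite -[RHS](string_closedP clI).
  apply/setP => p; rewrite !inE ffunE inordK // ltnS -cI -sum_string_cnt.
  by rewrite (bigD1 p.1) //= leq_addr.
have segM (k : {ffun 'I_n -> 'I_r.+1}) c : [ffun c => inord (string_cnt (string_seg (fun c
  => k c)) c)] == k ->
  #|string_seg (fun c => k c)| == r -> (k c <= M)%N.
  move=> /eqP/ffunP/(_ c) + /eqP cr; rewrite ffunE => /(congr1 val) /=.
  rewrite inordK => [<-|]; last first.
    by rewrite ltnS -[X in (_ <= X)%N]cr -sum_string_cnt (bigD1 c) //= leq_addr.
  by rewrite -[X in (_ <= X)%N](card_ord M) max_card.
have cond (k : {ffun 'I_n -> 'I_r.+1}) :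
   [&& (string_seg (fun c => k c) \subset A) && (#|string_seg (fun c => k c)| == r),
    string_closed (string_seg (fun c => k c)) &
    [ffun c => inord (string_cnt (string_seg (fun c => k c)) c)] == k] =
   compositions k && [forall c, (k c <= B c)%N].
  apply/and3P/andP => [[/andP[sA cr] cl kk]|[comp /forallP kB]].
    have kM c : (k c <= M)%N by apply: segM.
    split; last first.
      apply/forallP => c; case: (posnP (k c)) => [->//|k0].
      have ltM : ((k c).-1 < M)%N by have := kM c; lia.
      move/subsetP/(_ (c, Ordinal ltM)): sA; rewrite !inE /=; lia.
    by rewrite /compositions -[X in _ == X](eqP cr) -sum_string_cnt;
      apply/eqP/eq_bigr => c _;
      rewrite (string_segK (k := fun c => k c)).
  have kM c : (k c <= M)%N := leq_trans (kB c) (B_le c).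
  split.
  - apply/andP; split; first by apply/subsetP => -[c a]; rewrite !inE /= => /leq_trans ->.
    rewrite -sum_string_cnt -[X in _ == X](eqP comp); apply/eqP/eq_bigr => c _.
    by rewrite (string_segK (k := fun c => k c)).
  - apply/forallP => c; apply/forallP => a; apply/forallP => b; apply/implyP => /eqP ba.
    by apply/implyP; rewrite !inE /=; lia.
  - apply/eqP/ffunP => c; rewrite ffunE; apply: val_inj => /=.
    by rewrite (string_segK (k := fun c => k c)) // inordK.
apply: eq_big => [k|k]; first by rewrite -andbA cond.
rewrite -andbA cond => /andP[_ /forallP kB].
exact: (hl_subset_term_string (k := fun c => k c)).
Qed.

End Lengths.
End Strings.

(** * Numerators and denominators *)

Lemma big_lt_gt (R : Type) (idx : R) (op : Monoid.com_law idx) n (F : 'I_n -> 'I_n -> R) :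
  \big[op/idx]_c \big[op/idx]_d F c d =
  op (\big[op/idx]_c F c c)
     (\big[op/idx]_(c < n) \big[op/idx]_(d < n | (c < d)%N) op (F c d) (F d c)).
Proof.
have -> : \big[op/idx]_(c < n) \big[op/idx]_(d < n | (c < d)%N) op (F c d) (F d c) =
    op (\big[op/idx]_(c < n) \big[op/idx]_(d < n | (c < d)%N) F c d)
       (\big[op/idx]_(c < n) \big[op/idx]_(d < n | (d < c)%N) F c d).
  rewrite [X in _ = op _ X](exchange_big_dep xpredT) //= -big_split /=.
  by apply: eq_bigr => c _; rewrite big_split.
rewrite -!big_split /=; apply: eq_bigr => c _.
rewrite (bigD1 c) //= (bigID (fun d : 'I_n => (c < d)%N)) /=; congr (op _ (op _ _)).
  by apply: eq_bigl => d; rewrite -val_eqE /= neq_ltn; case: ltngtP.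
by apply: eq_bigl => d; rewrite -val_eqE /= neq_ltn; case: ltngtP.
Qed.

Section PairFactor.
Variables (K : fieldType) (z p : K).
Hypotheses (z_neq0 : z != 0) (p_neq0 : p != 0).

(* Up to monomials, both sides are the product of the 1 - z p^j, -kc <= j <= kd. *)
Lemma pair_den_factor kc kd :
  let X := \prod_(j < kc) - (z^-1 * p ^ j.+1%:Z) in
  let Y := \prod_(b < kd) - (z^-1 * p ^ (kc%:Z - b%:Z)) in
  (\prod_(a < kc) (1 - z * p ^ (kd%:Z - a%:Z))) *
  (\prod_(b < kd) (1 - z^-1 * p ^ (kc%:Z - b%:Z))) * (1 - z * p ^ (kd%:Z - kc%:Z)) * X =
  qpoch z p kd.+1 * qpoch (p / z) p kc * Y.
Proof.
move=> X Y; pose Psi := \prod_(j < kc + kd.+1) (1 - z * p ^ (j%:Z - kc%:Z)).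
have flip (e f : int) : e + f = 0 -> 1 - z^-1 * p ^ e = - (z^-1 * p ^ e) * (1 - z * p ^ f).
  move=> ef; have pe : p ^ e * p ^ f = 1 by rewrite -expfzDr // ef expr0z.
  transitivity (z^-1 * z * (p ^ e * p ^ f) - z^-1 * p ^ e); last by ring.
  by rewrite pe mulVf // !mulr1.
have -> : qpoch z p kd.+1 * qpoch (p / z) p kc = X * Psi.
  rewrite /Psi big_split_ord /= mulrC mulrA; congr (_ * _); last first.
    by apply: eq_bigr => j _; rewrite (_ : (kc + j)%:Z - kc%:Z = j) //; lia.
  rewrite [in RHS](reindex_inj rev_ord_inj) /= /qpoch -big_split /=.
  apply: eq_bigr => j _; rewrite -flip; last by have := ltn_ord j; lia.
  by rewrite [p / z]mulrC -mulrA -exprS.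
have -> : \prod_(b < kd) (1 - z^-1 * p ^ (kc%:Z - b%:Z)) =
    Y * \prod_(b < kd) (1 - z * p ^ (b%:Z - kc%:Z)).
  by rewrite -big_split; apply: eq_bigr => b _; apply: flip; lia.
have -> : Psi = (\prod_(b < kd) (1 - z * p ^ (b%:Z - kc%:Z))) *
   (1 - z * p ^ (kd%:Z - kc%:Z)) * \prod_(a < kc) (1 - z * p ^ (kd%:Z - a%:Z)).
  rewrite /Psi (_ : kc + kd.+1 = kd.+1 + kc)%N; last by rewrite addnC.
  rewrite big_split_ord big_ord_recr /=; congr (_ * _).
  rewrite [in LHS](reindex_inj rev_ord_inj) /=.
  apply: eq_bigr => a _; congr (1 - z * p ^ _); have := ltn_ord a; lia.
ring.
Qed.

End PairFactor.

(** * Numerators as signed sums of monomials *)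

Section Numerators.
Variables (K : fieldType) (q : K) (n : nat).
Hypotheses (q_neq0 : q != 0) (q_expn_neq1 : forall i, (0 < i)%N -> q ^+ i != 1).

Section Base.
Variables (beta m : nat).
Hypothesis (le_n_beta : (n <= beta)%N).
Local Notation pt := (string_pt beta).
Implicit Types (k : 'I_n -> nat) (s : 'S_n).

(* The limit of string_term when the lengths of the strings tend to infinity. *)
Definition string_weight k : K :=
  \prod_c \prod_(a < k c) (q ^+ pt c a ^+ m *
    \prod_d (q ^+ pt c a / (q ^+ pt c a - q ^+ pt d (k d)))).

(** Stated over any ring because it is evaluated both at q in [fps K], where it converges, and at
    the image of q in the fraction field, where the weights live. *)
Definition string_den (R : comNzRingType) (x : R) k : R :=
  \prod_c qpoch (x ^+ beta) (x ^+ beta) (k c) *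
  \prod_(c < n) \prod_(d < n | (c < d)%N)
    (qpoch (x ^+ (d - c)) (x ^+ beta) (k d).+1 *
     qpoch (x ^+ (beta - (d - c))) (x ^+ beta) (k c)).

(** The exponent of X / Y in [pair_den_factor] for z = q^(d - c) and p = q^beta. *)
Definition pair_exp k (c d : 'I_n) : int :=
  \sum_(j < k c) (beta%:Z * j.+1%:Z - (d%:Z - c%:Z)) -
  \sum_(b < k d) (beta%:Z * ((k c)%:Z - b%:Z) - (d%:Z - c%:Z)).

(** The three sums come from the factors x_i^m, from the monomials of the pairs c < d, and from the
    term of s in the Vandermonde determinant. *)
Definition num_exp k s : int :=
  \sum_c \sum_(a < k c) (m%:Z * (pt c a)%:Z) +
  \sum_(c < n) \sum_(d < n | (c < d)%N) (pair_exp k c d - (pt c (k c))%:Z) +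
  \sum_(i < n) (i%:Z * (pt (s i) (k (s i)))%:Z).

Lemma prod_exprz (I : finType) (P : pred I) (e : I -> int) :
  \prod_(i | P i) q ^ e i = q ^ (\sum_(i | P i) e i).
Proof.
elim/big_rec2: _ => [|i a b _ ->]; first by rewrite expr0z.
by rewrite expfzDr.
Qed.

Lemma string_ratio k (c d : 'I_n) a :
  q ^+ pt c a / (q ^+ pt c a - q ^+ pt d (k d)) =
  (1 - q ^ ((pt d (k d))%:Z - (pt c a)%:Z))^-1.
Proof.
have u : q ^+ pt c a != 0 by exact: expf_neq0.
rewrite expfzDr // -invr_expz -!exprnP (_ : 1 - _ = (q ^+ pt c a - q ^+ pt d (k d)) / q ^+
  pt c a).
  by rewrite invf_div.
by field.
Qed.

Lemma one_sub_exprz_neq0 (c d : 'I_n) a b : (c, a) != (d, b) ->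
  1 - q ^ ((pt d b)%:Z - (pt c a)%:Z) != 0.
Proof.
move=> ne; have := string_sub_neq0 q_neq0 q_expn_neq1 le_n_beta ne.
have u : q ^+ pt c a != 0 by exact: expf_neq0.
rewrite expfzDr // -invr_expz -!exprnP; apply: contraNN => /eqP e.
rewrite (_ : _ - _ = q ^+ pt c a * (1 - q ^+ pt d b / q ^+ pt c a)); last by field.
by rewrite e mulr0.
Qed.

(** This is [pair_den_factor] at z = q^(d - c), p = q^beta. Its isolated factor 1 - z p^(kd - kc)
    becomes, up to a monomial, the difference of the values at the two string ends; over all pairs
    these differences form a Vandermonde product. *)
Lemma string_pair k (c d : 'I_n) : (c < d)%N ->
  (\prod_(a < k c) (1 - q ^ ((pt d (k d))%:Z - (pt c a)%:Z))^-1 *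
   \prod_(a < k d) (1 - q ^ ((pt c (k c))%:Z - (pt d a)%:Z))^-1) *
  (qpoch (q ^+ (d - c)) (q ^+ beta) (k d).+1 *
   qpoch (q ^+ (beta - (d - c))) (q ^+ beta) (k c)) =
  q ^ (pair_exp k c d - (pt c (k c))%:Z) *
  ((-1) ^+ (k c + k d) * (q ^+ pt c (k c) - q ^+ pt d (k d))).
Proof.
move=> cd; have cd_beta : (d - c <= beta)%N.
  by have := ltn_ord d; have := ltn_ord c; lia.
have zE : q ^+ (d - c) = q ^ (d%:Z - c%:Z) by rewrite exprnP; congr (q ^ _); lia.
have pzE : q ^+ (beta - (d - c)) = q ^+ beta / q ^+ (d - c).
  by rewrite -[X in _ = q ^+ X / _](subnK cd_beta) exprD mulfK // expf_neq0.
have z0 : q ^+ (d - c) != 0 by exact: expf_neq0.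
have p0 : q ^+ beta != 0 by exact: expf_neq0.
have := pair_den_factor z0 p0 (k c) (k d); rewrite -pzE /=.
have zp e : q ^+ (d - c) * (q ^+ beta) ^ e = q ^ (d%:Z - c%:Z + beta%:Z * e).
  by rewrite zE [q ^+ beta]exprnP exprz_exp -expfzDr.
have zVp e : (q ^+ (d - c))^-1 * (q ^+ beta) ^ e = q ^ (beta%:Z * e - (d%:Z - c%:Z)).
  by rewrite zE [q ^+ beta]exprnP exprz_exp invr_expz -expfzDr // addrC.
have -> : \prod_(a < k c) (1 - q ^+ (d - c) * (q ^+ beta) ^ ((k d)%:Z - a%:Z)) =
   (\prod_(a < k c) (1 - q ^ ((pt d (k d))%:Z - (pt c a)%:Z))^-1)^-1.
  rewrite -prodfV; apply: eq_bigr => a _; rewrite invrK zp; congr (1 - q ^ _).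
  by rewrite /string_pt; lia.
have -> : \prod_(b < k d) (1 - (q ^+ (d - c))^-1 * (q ^+ beta) ^ ((k c)%:Z - b%:Z)) =
   (\prod_(a < k d) (1 - q ^ ((pt c (k c))%:Z - (pt d a)%:Z))^-1)^-1.
  rewrite -prodfV; apply: eq_bigr => a _; rewrite invrK zVp; congr (1 - q ^ _).
  by rewrite /string_pt; lia.
have -> : 1 - q ^+ (d - c) * (q ^+ beta) ^ ((k d)%:Z - (k c)%:Z) =
   q ^ (- (pt c (k c))%:Z) * (q ^+ pt c (k c) - q ^+ pt d (k d)).
  have qD e (a : nat) : q ^ e * q ^+ a = q ^ (e + a%:Z) by rewrite expfzDr.
  rewrite zp [RHS]mulrBr !qD addNr expr0z; congr (1 - q ^ _).
  by rewrite /string_pt; lia.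
have -> : \prod_(j < k c) - ((q ^+ (d - c))^-1 * (q ^+ beta) ^ j.+1%:Z) =
   (-1) ^+ k c * q ^ (\sum_(j < k c) (beta%:Z * j.+1%:Z - (d%:Z - c%:Z))).
  by rewrite -prod_exprz prodrN card_ord; congr (_ * _); apply: eq_bigr => j _; rewrite zVp.
have -> : \prod_(b < k d) - ((q ^+ (d - c))^-1 * (q ^+ beta) ^ ((k c)%:Z - b%:Z)) =
   (-1) ^+ k d * q ^ (\sum_(b < k d) (beta%:Z * ((k c)%:Z - b%:Z) - (d%:Z - c%:Z))).
  by rewrite -prod_exprz prodrN card_ord; congr (_ * _); apply: eq_bigr => j _; rewrite zVp.
have n1 : \prod_(a < k c) (1 - q ^ ((pt d (k d))%:Z - (pt c a)%:Z))^-1 != 0.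
  apply/prodf_neq0 => a _; rewrite invr_eq0 one_sub_exprz_neq0 //.
  by apply/eqP => /(congr1 (fun u => val u.1)) /=; lia.
have n2 : \prod_(a < k d) (1 - q ^ ((pt c (k c))%:Z - (pt d a)%:Z))^-1 != 0.
  apply/prodf_neq0 => a _; rewrite invr_eq0 one_sub_exprz_neq0 //.
  by apply/eqP => /(congr1 (fun u => val u.1)) /=; lia.
rewrite /pair_exp -addrA [in q ^ (_ + (_ + _))]addrC ![q ^ (_ + _)]expfzDr //.
rewrite -(invr_expz q (\sum_(b < k d) _)) exprD.
set sd := (-1) ^+ k d; have sd2 : sd * sd = 1 by rewrite /sd -expr2 sqrr_sign.
set sc := (-1) ^+ k c; set Y := q ^ (\sum_(b < k d) _).
have Y0 : Y != 0 by exact: expfz_neq0.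
set u := \prod_(a < k c) _ in n1 *; set v := \prod_(a < k d) _ in n2 *.
set D1 := qpoch _ _ (k d).+1; set D2 := qpoch _ _ (k c).
set X := q ^ (\sum_(j < k c) _); set Z := q ^ (- _); set W := _ - _.
move=> e; transitivity (u * v * (D1 * D2 * (sd * Y)) * (sd * Y^-1)).
  transitivity (u * v * (D1 * D2) * (sd * sd) * (Y * Y^-1)); last by ring.
  by rewrite sd2 mulfV // !mulr1.
by rewrite -e; field; rewrite n1 n2 Y0.
Qed.

(** The factors with c = d cancel (q^beta; q^beta)_(k c) exactly, and each pair c < d is
    [string_pair]. *)
Lemma string_weight_den k :
  string_weight k * string_den q k =
  q ^ (\sum_c \sum_(a < k c) (m%:Z * (pt c a)%:Z) +
       \sum_(c < n) \sum_(d < n | (c < d)%N) (pair_exp k c d - (pt c (k c))%:Z)) *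
  \prod_(c < n) \prod_(d < n | (c < d)%N)
    ((-1) ^+ (k c + k d) * (q ^+ pt c (k c) - q ^+ pt d (k d))).
Proof.
pose f c d := \prod_(a < k c) (1 - q ^ ((pt d (k d))%:Z - (pt c a)%:Z))^-1.
have -> : string_weight k = q ^ (\sum_c \sum_(a < k c) (m%:Z * (pt c a)%:Z)) *
    \prod_c \prod_d f c d.
  rewrite -prod_exprz -big_split /=; apply: eq_bigr => c _.
  rewrite -prod_exprz exchange_big -big_split /=; apply: eq_bigr => a _.
  rewrite -exprM mulnC exprnP PoszM; congr (_ * _).
  by apply: eq_bigr => d _; rewrite string_ratio.
have fcc c : f c c * qpoch (q ^+ beta) (q ^+ beta) (k c) = 1.
  rewrite /f /qpoch (reindex_inj rev_ord_inj) -big_split /= big1 // => a _.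
  have := @one_sub_exprz_neq0 c c (k c - a.+1)%N (k c).
  have := ltn_ord a; rewrite (_ : _ - _ = (beta * a.+1)%N%:Z); last first.
    have : (beta * (k c - a.+1) + beta * a.+1 = beta * k c)%N by rewrite -mulnDr subnK.
    by rewrite /string_pt; lia.
  rewrite -exprnP exprM -exprS => ak ne; rewrite mulVf // ne //.
  by apply/eqP => -[]; lia.
rewrite big_lt_gt /string_den /=.
set F := \prod_c f c c; set H := \prod_c qpoch _ _ _.
set I := \prod_(c < n) \prod_(d < n | _) _; set G := \prod_(c < n) \prod_(d < n | _) (qpoch
  _ _ _ * _).
have FH : F * H = 1 by rewrite /F /H -big_split; apply: big1 => c _; apply: fcc.
transitivity (q ^ (\sum_c \sum_(a < k c) (m%:Z * (pt c a)%:Z)) * (F * H) * (I * G)).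
  by ring.
rewrite FH mulr1 expfzDr // -mulrA /I /G; congr (_ * _).
rewrite -prod_exprz -!big_split /=; apply: eq_bigr => c _.
by rewrite -prod_exprz -!big_split /=; apply: eq_bigr => d cd; rewrite -string_pair.
Qed.

Lemma vandermonde_exprn (y : 'I_n -> nat) :
  \prod_(c < n) \prod_(d < n | (c < d)%N) (q ^+ y d - q ^+ y c) =
  \sum_(s : 'S_n) (-1) ^+ s * q ^ (\sum_(i < n) (i%:Z * (y (s i))%:Z)).
Proof.
transitivity (\det (Vandermonde n (\row_j q ^+ y j))).
  rewrite det_Vandermonde; apply: eq_bigr => c _; apply: eq_bigr => d _.
  by rewrite !mxE.
apply: eq_bigr => s _; rewrite -prod_exprz; congr (_ * _); apply: eq_bigr => i _.
by rewrite !mxE -exprM exprnP mulnC PoszM.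
Qed.

(** The successor in the sign exponent accounts for reversing each difference to the orientation of
    the Vandermonde product. *)
Lemma string_num_expand k :
  string_weight k * string_den q k =
  (-1) ^+ (\sum_(c < n) \sum_(d < n | (c < d)%N) (k c + k d).+1) *
  \sum_(s : 'S_n) (-1) ^+ s * q ^ num_exp k s.
Proof.
rewrite string_weight_den.
have -> : \prod_(c < n) \prod_(d < n | (c < d)%N)
    ((-1) ^+ (k c + k d) * (q ^+ pt c (k c) - q ^+ pt d (k d))) =
  (-1) ^+ (\sum_(c < n) \sum_(d < n | (c < d)%N) (k c + k d).+1) *
  \prod_(c < n) \prod_(d < n | (c < d)%N) (q ^+ pt d (k d) - q ^+ pt c (k c)).
  rewrite -prodrXr -big_split /=; apply: eq_bigr => c _.
  rewrite -prodrXr -big_split /=; apply: eq_bigr => d _; rewrite exprS; ring.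
rewrite mulrCA (vandermonde_exprn (fun c => pt c (k c))) mulr_sumr; congr (_ * _).
by apply: eq_bigr => s _; rewrite mulrCA -expfzDr.
Qed.

Lemma sum_succ_affine (x y : int) K0 :
  2 * \sum_(j < K0) (x * j.+1%:Z - y) = x * K0%:Z * (K0%:Z + 1) - 2 * y * K0%:Z.
Proof.
clear le_n_beta q_neq0 q_expn_neq1.
by elim: K0 => [|K0 IH]; rewrite ?big_ord0 ?mulr0 ?mul0r ?subr0 // big_ord_recr mulrDr IH
  /=; lia.
Qed.

(* The factor 4 clears the halves in the binomials of the pair exponents. *)
Lemma num_exp4 k s r : (\sum_c k c)%N = r ->
  4 * num_exp k s =
  4 * (m%:Z + n%:Z) * \sum_(c < n) (c%:Z * (k c)%:Z) + 4 * beta%:Z * \sum_(c < n) (c%:Z *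
    (k (s c))%:Z) +
  2 * beta%:Z * (m%:Z + n%:Z) * \sum_c (k c)%:Z ^+ 2 + 4 * \sum_(c < n) (c%:Z * (s c)%:Z)
  - 4 * (\sum_(c < n) \sum_(d < n | (c < d)%N) c%:Z)
  - 2 * beta%:Z * r%:Z * (m%:Z + n%:Z + r%:Z - 1) - 4 * r%:Z * \sum_(c < n) c%:Z.
Proof.
clear le_n_beta q_neq0 q_expn_neq1; move=> kr; have kr' : \sum_c (k c)%:Z = r%:Z by rewrite
  -kr (big_morph _ PoszD (erefl _)).
pose P := \sum_(c < n) (c%:Z * (k c)%:Z); pose R := \sum_(c < n) (c%:Z * (k (s c))%:Z).
pose Q := \sum_c (k c)%:Z ^+ 2; pose C := \sum_(c < n) c%:Z.
pose W := \sum_(c < n) (c%:Z * (s c)%:Z).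
have E1 : 2 * \sum_c \sum_(a < k c) (m%:Z * (pt c a)%:Z) =
    m%:Z * (2 * P + beta%:Z * Q - beta%:Z * r%:Z).
  transitivity (\sum_(c < n) (2 * m%:Z * (c%:Z * (k c)%:Z) + m%:Z * beta%:Z * (k c)%:Z ^+ 2
      - m%:Z * beta%:Z * (k c)%:Z)); last first.
    by rewrite !big_split /= sumrN -!mulr_sumr kr' /P /Q; ring.
  rewrite mulr_sumr; apply: eq_bigr => c _; rewrite /string_pt.
  elim: (k c) => [|j IH]; first by rewrite big_ord0; ring.
  by rewrite big_ord_recr mulrDr IH /= -natr1 expr2; lia.
have E3 : \sum_(i < n) (i%:Z * (pt (s i) (k (s i)))%:Z) = W + beta%:Z * R.
  rewrite /W /R mulr_sumr -big_split; apply: eq_bigr => i _ /=.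
  by rewrite /string_pt; lia.
pose g c d : int := beta%:Z * ((k c)%:Z - (k d)%:Z) ^+ 2 - beta%:Z * ((k c)%:Z + (k d)%:Z)
   + 2 * (d%:Z - c%:Z) * ((k d)%:Z - (k c)%:Z).
have E2 : 2 * \sum_(c < n) \sum_(d < n | (c < d)%N) (pair_exp k c d - (pt c (k c))%:Z) =
    \sum_(c < n) \sum_(d < n | (c < d)%N) g c d - 2 * \sum_(c < n) \sum_(d < n | (c < d)%N)
      c%:Z.
  rewrite !mulr_sumr -sumrB; apply: eq_bigr => c _.
  rewrite !mulr_sumr -sumrB; apply: eq_bigr => d _.
  rewrite mulrBr /pair_exp mulrBr sum_succ_affine /g /string_pt.
  have -> : 2 * \sum_(b < k d) (beta%:Z * ((k c)%:Z - b%:Z) - (d%:Z - c%:Z)) =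
     2 * beta%:Z * (k c)%:Z * (k d)%:Z - beta%:Z * (k d)%:Z * ((k d)%:Z - 1) - 2 * (d%:Z -
       c%:Z) * (k d)%:Z.
    elim: (k d) => [|j IH]; first by rewrite big_ord0; ring.
    by rewrite big_ord_recr mulrDr IH /=; lia.
  rewrite PoszD PoszM; ring.
have E4 : 2 * \sum_(c < n) \sum_(d < n | (c < d)%N) g c d =
    2 * n%:Z * beta%:Z * Q - 2 * beta%:Z * r%:Z ^+ 2 - 2 * n%:Z * beta%:Z * r%:Z
    + 4 * n%:Z * P - 4 * C * r%:Z + 2 * beta%:Z * r%:Z.
  have sym : 2 * \sum_(c < n) \sum_(d < n | (c < d)%N) g c d =
      \sum_(c < n) \sum_(d < n | (c < d)%N) (g c d + g d c).
    rewrite mulr_sumr; apply: eq_bigr => c _; rewrite mulr_sumr; apply: eq_bigr => d _.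
    by rewrite /g; ring.
  rewrite sym; have e : \sum_c \sum_d g c d = \sum_c g c c +
      \sum_(c < n) \sum_(d < n | (c < d)%N) (g c d + g d c) := big_lt_gt +%R g.
  have -> : \sum_(c < n) \sum_(d < n | (c < d)%N) (g c d + g d c) =
     \sum_c \sum_d g c d - \sum_c g c c by rewrite e [X in X - _]addrC addrK.
  have -> : \sum_c g c c = - 2 * beta%:Z * r%:Z.
    rewrite -kr' mulr_sumr; apply: eq_bigr => c _; rewrite /g; ring.
  have cst (x : int) : \sum_(d < n) x = n%:Z * x.
    by rewrite sumr_const card_ord -mulr_natl natz.
  have -> : \sum_c \sum_d g c d = \sum_(c < n)
     ((n%:Z * beta%:Z) * (k c)%:Z ^+ 2 + beta%:Z * Q + (- 2 * beta%:Z * r%:Z) * (k c)%:Z +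
      (- n%:Z * beta%:Z) * (k c)%:Z - beta%:Z * r%:Z + 2 * P + (- 2 * C) * (k c)%:Z
      + (- 2 * r%:Z) * c%:Z + (2 * n%:Z) * (c%:Z * (k c)%:Z)).
    apply: eq_bigr => c _.
    transitivity (\sum_(d < n) ((beta%:Z * (k c)%:Z ^+ 2 - beta%:Z * (k c)%:Z + 2 * (c%:Z *
      (k c)%:Z))
       + beta%:Z * (k d)%:Z ^+ 2 + (- 2 * beta%:Z * (k c)%:Z - beta%:Z - 2 * c%:Z) * (k
         d)%:Z
       + 2 * (d%:Z * (k d)%:Z) + (- 2 * (k c)%:Z) * d%:Z)).
      by apply: eq_bigr => d _; rewrite /g; ring.
    rewrite !big_split /= -!mulr_sumr !cst kr' -/P -/Q -/C; ring.
  rewrite !big_split /= -!mulr_sumr !cst kr' -/P -/Q -/C; ring.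
rewrite /num_exp E3 -/P -/R -/Q -/C -/W.
set S1 := \sum_c \sum_(a < k c) _ in E1 *; set S2 := \sum_c \sum_(d | _) (_ - _) in E2 *.
set S3 := \sum_c \sum_(d | _) g c d in E2 E4.
set S4 := \sum_c \sum_(d | _) _%:Z in E2 *.
transitivity (2 * (2 * S1) + (2 * (2 * S2)) + 4 * (W + beta%:Z * R)); first by ring.
rewrite E1 E2 (_ : 2 * (S3 - 2 * S4) = 2 * S3 - 4 * S4); last by ring.
by rewrite E4; ring.
Qed.

End Base.
Lemma double_bin2 r : 2 * 'C(r, 2)%:Z = r%:Z * (r%:Z - 1).
Proof. by elim: r => // r IH; rewrite binS bin1; lia. Qed.

(* The affine Weyl group symmetry behind the level-rank exchange. *)
Lemma num_exp_swap m (k : 'I_n -> nat) (s : 'S_n) r : (\sum_c k c)%N = r ->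
  num_exp n m k s =
  (m * 'C(r, 2))%N%:Z + num_exp (m + n) 0 (fun c => k (s c)) s^-1%g.
Proof.
move=> kr; have kr' : (\sum_c k (s c))%N = r by rewrite -kr [RHS](reindex_inj (@perm_inj _
  s)).
have := num_exp4 n m s kr; have := num_exp4 (m + n)%N 0 s^-1%g kr'.
have -> : \sum_(c < n) (c%:Z * (k (s (s^-1%g c)))%:Z) = \sum_(c < n) (c%:Z * (k c)%:Z).
  by apply: eq_bigr => c _; rewrite permKV.
have -> : \sum_c (k (s c))%:Z ^+ 2 = \sum_c (k c)%:Z ^+ 2.
  by rewrite [RHS](reindex_inj (@perm_inj _ s)).
have -> : \sum_(c < n) (c%:Z * (s^-1%g c)%:Z) = \sum_(c < n) (c%:Z * (s c)%:Z).
  rewrite (reindex_inj (@perm_inj _ s)); apply: eq_bigr => c _.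
  by rewrite permK mulrC.
rewrite PoszM PoszD => e1 e2; apply: (@mulfI int 4%:R) => //.
rewrite e2 [RHS]mulrDr e1 (_ : 4 * (m%:Z * _) = 2 * m%:Z * (2 * 'C(r, 2)%:Z)); last by ring.
by rewrite double_bin2; ring.
Qed.

(** The match is between pairs (k, s) and (k o s, s^-1) by [num_exp_swap], so it needs the sum over
    all compositions; inversion keeps the sign of s. *)
Lemma string_num_eq m r :
  \sum_(k : {ffun 'I_n -> 'I_r.+1} | compositions k)
    string_weight n m (fun c => k c) * string_den n q (fun c => k c) =
  q ^+ (m * 'C(r, 2)) *
  \sum_(k : {ffun 'I_n -> 'I_r.+1} | compositions k)
    string_weight (m + n) 0 (fun c => k c) * string_den (m + n) q (fun c => k c).
Proof.
(* The sign in [string_num_expand] depends on n and r alone, since the sum of k c + k d over c < d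
   is (n - 1) r. *)
pose sg : K := (-1) ^+ (n * r - r + \sum_(c < n) \sum_(d < n | (c < d)%N) 1).
have sgE (k : {ffun 'I_n -> 'I_r.+1}) : compositions k ->
    (-1) ^+ (\sum_(c < n) \sum_(d < n | (c < d)%N) (k c + k d).+1) = sg.
  move/eqP=> kr; congr (_ ^+ _).
  have e : (\sum_(c < n) \sum_(d < n) k c = \sum_c k c +
    \sum_(c < n) \sum_(d < n | (c < d)%N) (k c + k d))%N := big_lt_gt addn (fun c _ => k c
      : nat).
  have e1 : (\sum_(c < n) \sum_(d < n) k c = n * r)%N.
    by rewrite exchange_big /= sum_nat_const card_ord kr.
  have -> : (\sum_(c < n) \sum_(d < n | (c < d)%N) (k c + k d).+1 =
     \sum_(c < n) \sum_(d < n | (c < d)%N) (k c + k d) + \sum_(c < n) \sum_(d < n | (c <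
       d)%N) 1)%N.
    rewrite -big_split; apply: eq_bigr => c _; rewrite -big_split.
    by apply: eq_bigr => d _; rewrite /= addn1.
  by rewrite -e1 e kr addKn.
transitivity (sg * \sum_(s : 'S_n) (-1) ^+ s *
    \sum_(k : {ffun 'I_n -> 'I_r.+1} | compositions k) q ^ num_exp n m (fun c => k c) s).
  rewrite mulr_sumr; under [RHS]eq_bigr do rewrite !mulr_sumr.
  rewrite [RHS]exchange_big; apply: eq_bigr => k kr.
  by rewrite (string_num_expand m (leqnn n)) sgE // mulr_sumr.
transitivity (sg * q ^+ (m * 'C(r, 2)) * \sum_(s : 'S_n) (-1) ^+ s *
    \sum_(k : {ffun 'I_n -> 'I_r.+1} | compositions k) q ^ num_exp (m + n) 0 (fun c => k c)
      s); last first.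
  rewrite [LHS]mulr_sumr [RHS]mulr_sumr; under [LHS]eq_bigr do rewrite !mulr_sumr.
  rewrite [LHS]exchange_big; apply: eq_bigr => k kr.
  rewrite (string_num_expand 0 (leq_addl m n)) sgE // !mulr_sumr.
  by apply: eq_bigr => s _; rewrite -mulrA mulrCA.
rewrite [LHS]mulr_sumr [RHS]mulr_sumr [RHS](reindex_inj invg_inj); apply: eq_bigr => s _ /=.
rewrite odd_permV [RHS]mulrACA [LHS]mulrA; congr (_ * _).
pose h (w : 'S_n) (k : {ffun 'I_n -> 'I_r.+1}) := [ffun c => k (w c)].
rewrite mulr_sumr [RHS](reindex_onto (h s) (h s^-1%g)) /=; last first.
  by move=> k _; apply/ffunP => c; rewrite !ffunE permK.
apply: eq_big => [k|k /eqP kr].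
  rewrite /compositions (_ : h _ (h s k) = k); last by apply/ffunP => c;
    rewrite !ffunE permKV.
  rewrite eqxx andbT (reindex_inj (@perm_inj _ s)); congr (_ == _).
  by apply: eq_bigr => c _; rewrite ffunE.
rewrite (num_exp_swap m s kr) expfzDr //; congr (_ * q ^ _).
have -> // : (fun c => (h s k) c : nat) = (fun c => k (s c) : nat).
by apply/boolp.funext => c; rewrite ffunE.
Qed.

End Numerators.

(** * Formal power series modulo powers of q *)

Section FpsTheory.
Variable K : fieldType.
Implicit Types (f g h : fps K).
Local Notation q := (fps_q K).

Lemma fps_coefM f g k :
  fps_coef (f * g) k = \sum_(i < k.+1) fps_coef f i * fps_coef g (k - i).
Proof. by []. Qed.

Lemma fps_coefB f g k : fps_coef (f - g) k = fps_coef f k - fps_coef g k.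
Proof. by []. Qed.

Lemma fps_coef0M f g : fps_coef (f * g) 0 = fps_coef f 0 * fps_coef g 0.
Proof. by rewrite fps_coefM big_ord1. Qed.

Lemma fps_coef1 k : fps_coef (1 : fps K) k = (k == 0%N)%:R.
Proof. by rewrite -[LHS]/((1 : {poly K})`_k) coef1. Qed.

Lemma fps_unitE f : (f \is a GRing.unit) = (fps_coef f 0 != 0).
Proof. by []. Qed.

(** Lowest nonzero coefficients multiply. The resulting domain structure gives access to
    [{fraction (fps K)}]. *)
Lemma fps_mulf_eq0 f g : f * g = 0 -> (f == 0) || (g == 0).
Proof.
have low h : h != 0 -> {i | fps_coef h i != 0 & forall j, (j < i)%N -> fps_coef h j = 0}.
  move=> h0; have ex : exists i, fps_coef h i != 0.
    apply: contraPP (negP h0) => /forallNP nex; apply; apply/eqP/fpsP => i.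
    by apply/eqP; apply: contraT => ne; case: (nex i ne).
  exists (ex_minn ex); first by case: ex_minnP.
  case: ex_minnP => i _ mini j ji; apply/eqP; apply: contraTT ji => hj.
  by rewrite -leqNgt; apply: mini.
move=> fg; apply: contraT; rewrite negb_or => /andP[/low[i fi ltf] /low[j gj ltg]].
move/(congr1 (fun h => fps_coef h (i + j)%N)): fg; rewrite fps_coefM.
have ltij : (i < (i + j).+1)%N by rewrite ltnS leq_addr.
rewrite (bigD1 (Ordinal ltij)) //= addKn big1 ?addr0 => [/eqP|u ui].
  by rewrite mulf_eq0 (negPf fi) (negPf gj).
case: (ltngtP u i) => [/ltf ->|iu|e]; first by rewrite mul0r.
  by rewrite ltg ?mulr0 //; have := ltn_ord u; lia.
by case/eqP: ui; apply: val_inj.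
Qed.

HB.instance Definition _ := GRing.ComUnitRing_isIntegral.Build (fps K) fps_mulf_eq0.

Lemma fps_of_polyB : {morph @fps_of_poly K : p r / p - r}.
Proof. by move=> p r; apply: fpsP => k; rewrite fps_coefB /= coefB. Qed.

Lemma fps_of_polyM : {morph @fps_of_poly K : p r / p * r}.
Proof. by move=> p r; apply: fpsP => k; rewrite fps_coefM /= coefM. Qed.

HB.instance Definition _ := GRing.isZmodMorphism.Build {poly K} (fps K) (@fps_of_poly K)
  fps_of_polyB.
HB.instance Definition _ := GRing.isMonoidMorphism.Build {poly K} (fps K) (@fps_of_poly K)
  (erefl, fps_of_polyM).

Lemma fps_qXn i : q ^+ i = fps_of_poly 'X^i.
Proof. by rewrite rmorphXn. Qed.

Lemma fps_coef_qXnM i f k :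
  fps_coef (q ^+ i * f) k = if (k < i)%N then 0 else fps_coef f (k - i).
Proof.
rewrite fps_qXn fps_coefM /=; case: ltnP => ik.
  apply: big1 => j _; rewrite coefXn (_ : _ == _ = false) ?mul0r //.
  by have := ltn_ord j; lia.
have ltik : (i < k.+1)%N by [].
rewrite (bigD1 (Ordinal ltik)) //= coefXn eqxx mul1r big1 ?addr0 // => j ji.
rewrite coefXn (_ : _ == _ = false) ?mul0r //; apply: contra_neqF ji => /eqP e.
exact: val_inj.
Qed.

Lemma fps_coef0_qXn i : fps_coef (q ^+ i) 0 = (i == 0%N)%:R.
Proof. by rewrite -[q ^+ i]mulr1 fps_coef_qXnM fps_coef1; case: i. Qed.

Definition qdvd M f := exists h, f = q ^+ M * h.

Lemma qdvdP M f : qdvd M f <-> (forall k, (k < M)%N -> fps_coef f k = 0).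
Proof.
split=> [[h ->] k kM|f0]; first by rewrite fps_coef_qXnM kM.
exists (Fps (fun k => fps_coef f (k + M))); apply: fpsP => k.
by rewrite fps_coef_qXnM; case: ltnP => [/f0//|Mk] /=; rewrite subnK.
Qed.

Lemma qdvd_qXn M i : (M <= i)%N -> qdvd M (q ^+ i).
Proof. by move=> Mi; exists (q ^+ (i - M)); rewrite -exprD subnKC. Qed.

Lemma qdvdD M f g : qdvd M f -> qdvd M g -> qdvd M (f + g).
Proof. by move=> [f' ->] [g' ->]; exists (f' + g'); rewrite mulrDr. Qed.

Lemma qdvdMl M f g : qdvd M g -> qdvd M (f * g).
Proof. by move=> [g' ->]; exists (f * g'); rewrite mulrCA. Qed.

Lemma qdvdMr M f g : qdvd M f -> qdvd M (f * g).
Proof. by move=> [f' ->]; exists (f' * g); rewrite mulrA. Qed.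

Lemma qdvdN M f : qdvd M f -> qdvd M (- f).
Proof. by move=> [f' ->]; exists (- f'); rewrite mulrN. Qed.

Lemma qdvd_eq f g : (forall M, qdvd M (f - g)) -> f = g.
Proof.
move=> fg; apply: fpsP => k; apply/eqP; rewrite -subr_eq0 -fps_coefB; apply/eqP.
exact: (proj1 (qdvdP k.+1 _) (fg _)).
Qed.

Lemma qdvd_sub_trans M f g h : qdvd M (f - g) -> qdvd M (g - h) -> qdvd M (f - h).
Proof. by move=> /qdvdD H /H; rewrite addrA subrK. Qed.

Lemma qdvd_subC M f g : qdvd M (f - g) -> qdvd M (g - f).
Proof. by move=> /qdvdN; rewrite opprB. Qed.

Lemma qdvd_subM M f g f' g' : qdvd M (f - f') -> qdvd M (g - g') -> qdvd M (f * g - f' *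
  g').
Proof.
move=> ff gg; have -> : f * g - f' * g' = (f - f') * g + f' * (g - g') by ring.
by apply: qdvdD; [apply: qdvdMr|apply: qdvdMl].
Qed.

Lemma qdvd_sub_prod M (I : Type) (s : seq I) (P : pred I) (F G : I -> fps K) :
  (forall i, P i -> qdvd M (F i - G i)) ->
  qdvd M (\prod_(i <- s | P i) F i - \prod_(i <- s | P i) G i).
Proof.
move=> FG; elim/big_ind2: _ => //; first by exists 0; rewrite subrr mulr0.
by move=> *; apply: qdvd_subM.
Qed.

Lemma qdvd_sub_prod1 M (I : Type) (s : seq I) (P : pred I) (F : I -> fps K) :
  (forall i, P i -> qdvd M (F i - 1)) -> qdvd M (\prod_(i <- s | P i) F i - 1).
Proof.
by move=> /(qdvd_sub_prod s (G := fun=> 1)); rewrite [X in _ - X]big1.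
Qed.

Lemma fps_cvg_qdvd (u : nat -> fps K) f :
  (forall M, exists n0, forall n, (n0 <= n)%N -> qdvd M (u n - f)) -> fps_cvg u f.
Proof.
move=> H k; have [n0 Hn] := H k.+1; exists n0 => n /Hn /qdvdP/(_ k (ltnSn k)) /eqP.
by rewrite fps_coefB subr_eq0 => /eqP.
Qed.

(** Coefficient k is frozen from index k + 1 on, so the limit is the diagonal series [f] of the
    proof. *)
Lemma fps_lim_qdvd (u : nat -> fps K) :
  (forall n, qdvd n (u n.+1 - u n)) -> forall M, qdvd M (u M - fps_lim u).
Proof.
move=> uS; have step n j : (n <= j)%N -> qdvd n (u j - u n).
  move=> nj; rewrite -(subnKC nj); elim: (j - n)%N => [|e IH].
    by rewrite addn0; exists 0; rewrite subrr mulr0.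
  rewrite addnS; apply: qdvd_sub_trans IH; apply/qdvdP => k kn.
  by move/qdvdP: (uS (n + e)%N); apply; rewrite (leq_trans kn) ?leq_addr.
pose f := Fps (fun k => fps_coef (u k.+1) k).
have cvg : fps_cvg u f.
  move=> k; exists k.+1 => n kn /=; apply/eqP; rewrite -subr_eq0 -fps_coefB; apply/eqP.
  by move/qdvdP: (step _ _ kn); apply.
rewrite (fps_cvg_lim cvg) => M; apply/qdvdP => k kM; rewrite fps_coefB /=.
apply/eqP; rewrite -fps_coefB; apply/eqP.
by move/qdvdP: (step _ _ kM); apply.
Qed.

Lemma qdvd_qpoch (a : fps K) beta M : (0 < beta)%N ->
  qdvd M (qpoch a (q ^+ beta) M - qpoch_inf a (q ^+ beta)).
Proof.
move=> b0; apply: fps_lim_qdvd => n.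
rewrite /qpoch big_ord_recr /= mulrBr mulr1 addrAC subrr add0r.
by apply/qdvdN/qdvdMl/qdvdMl; rewrite -exprM; apply/qdvd_qXn/leq_pmull.
Qed.

Lemma qdvd_leq M M' f : (M <= M')%N -> qdvd M' f -> qdvd M f.
Proof. by move=> le /qdvdP f0; apply/qdvdP => k kM; rewrite f0 ?(leq_trans kM). Qed.

Lemma qpoch_coef0 (a b : fps K) k : fps_coef a 0 = 0 -> fps_coef (qpoch a b k) 0 = 1.
Proof.
move=> a0; rewrite /qpoch; elim/big_ind: _ => [|f g f1 g1|i _]; first exact: fps_coef1.
  by rewrite fps_coef0M f1 g1 mulr1.
by rewrite fps_coefB fps_coef0M a0 mul0r subr0 fps_coef1.
Qed.

Lemma qpoch_inf_coef0 s beta : (0 < s)%N -> (0 < beta)%N ->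
  fps_coef (qpoch_inf (q ^+ s) (q ^+ beta)) 0 = 1.
Proof.
move=> s0 b0; have /qdvdP/(_ 0%N isT)/eqP := qdvd_qpoch (q ^+ s) 1 b0.
rewrite fps_coefB subr_eq0 => /eqP <-; apply: qpoch_coef0.
by rewrite fps_coef0_qXn; case: s s0.
Qed.

Lemma qpoch_inf_unit s beta : (0 < s)%N -> (0 < beta)%N ->
  qpoch_inf (q ^+ s) (q ^+ beta) \is a GRing.unit.
Proof. by move=> s0 b0; rewrite fps_unitE qpoch_inf_coef0 // oner_eq0. Qed.

(** The factors are sorted by their index modulo N, first in the partial product of N M factors. *)
Lemma qpoch_inf_split s beta N : (0 < beta)%N -> (0 < N)%N -> 
  qpoch_inf (q ^+ s) (q ^+ beta) =
  \prod_(j < N) qpoch_inf (q ^+ (s + beta * j)) (q ^+ (beta * N)).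
Proof.
move=> b0 N0; apply: qdvd_eq => M.
apply: (@qdvd_sub_trans _ _ (qpoch (q ^+ s) (q ^+ beta) (N * M))).
  by apply/qdvd_subC; apply: (@qdvd_leq _ (N * M)); rewrite ?leq_pmull //;
    apply: qdvd_qpoch.
have -> : qpoch (q ^+ s) (q ^+ beta) (N * M) =
    \prod_(j < N) qpoch (q ^+ (s + beta * j)) (q ^+ (beta * N)) M.
  rewrite /qpoch exchange_big /=; elim: M => [|M IH]; first by rewrite muln0 !big_ord0.
  rewrite mulnS addnC big_split_ord big_ord_recr /= IH; congr (_ * _).
  apply: eq_bigr => j _; rewrite -!exprM -!exprD; congr (1 - q ^+ _); lia.
by apply: qdvd_sub_prod => j _; apply: qdvd_qpoch; rewrite muln_gt0 b0.
Qed.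

End FpsTheory.

(** * Divisibility of the terms by powers of q *)

(** In increasing order, the entry of index i is at least i. This is the origin of the power q^(m
    C(r, 2)) in the theorem. *)
Lemma sum_uniq_geq_bin2 (s : seq nat) : uniq s -> ('C(size s, 2) <= \sum_(i <- s) i)%N.
Proof.
move=> us; rewrite -(perm_big _ (permEl (perm_sort leq s))) /=.
have st : sorted ltn (sort leq s).
  by rewrite ltn_sorted_uniq_leq sort_uniq us (sort_sorted leq_total).
rewrite -(size_sort leq) [X in (_ <= X)%N](big_nth 0%N) -bin2_sum !big_nat.
apply: leq_sum => i /= ilt; elim: i ilt => // i IH ilt.
apply: (leq_ltn_trans (IH (ltnW ilt))).
by apply: (sorted_ltn_nth ltn_trans) => //; rewrite inE // ltnW.
Qed.

(** At most y + 1 distinct numbers are <= y, and each of the others adds at least 1 to the sum. *)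
Lemma size_uniq_leq_sum (s : seq nat) y : uniq s -> (size s <= \sum_(i <- s) (i - y) +
  y.+1)%N.
Proof.
move=> us; rewrite -(count_predC (fun i => i <= y)%N) addnC; apply: leq_add; last first.
  rewrite -size_filter -[X in (_ <= X)%N](size_iota 0); apply: uniq_leq_size.
    exact: filter_uniq.
  by move=> i; rewrite mem_filter mem_iota add0n ltnS => /andP[].
rewrite -sum1_count [X in (_ <= X)%N](bigID (fun i => i <= y)%N) /= addnC.
apply: leq_trans (leq_addr _ _); apply: leq_sum => i; lia.
Qed.

Section StringEnum.
Variables (n beta : nat) (k : 'I_n -> nat).
Hypothesis (le_n_beta : (n <= beta)%N).

Lemma string_enum : exists s : seq nat, uniq s /\
  forall F : nat -> nat, (\sum_c \sum_(a < k c) F (string_pt beta c a) = \sum_(i <- s) F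
    i)%N.
Proof.
exists [seq string_pt beta c a | c <- enum 'I_n, a <- iota 0 (k c)]; split.
  apply: allpairs_uniq_dep; [exact: enum_uniq|by move=> *; exact: iota_uniq|].
  by move=> [c a] [d b] _ _ /= /(string_pt_inj le_n_beta) [-> ->].
move=> F; rewrite big_allpairs_dep big_enum; apply: eq_bigr => c _.
by rewrite -(big_mkord xpredT (fun a => F (string_pt beta c a))) /index_iota subn0.
Qed.

(** The r points are distinct, which gives m C(r, 2). Of the inner sum only e = d is kept: few
    points lie at or below the end of a short string d, and all others contribute. So one short
    string forces a high order. *)
Lemma string_sum_bound m (d : 'I_n) r : (\sum_c k c)%N = r ->
  (m * 'C(r, 2) + (r - (string_pt beta d (k d)).+1) <=
   \sum_c \sum_(a < k c) (m * string_pt beta c a +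
     \sum_e (string_pt beta c a - string_pt beta e (k e))))%N.
Proof.
move=> kr; have [s [us sE]] := string_enum.
have sr : size s = r.
  rewrite -kr -sum1_size -(sE (fun=> 1%N)); apply: eq_bigr => c _.
  by rewrite sum1_card card_ord.
rewrite (sE (fun i => (m * i + \sum_e (i - string_pt beta e (k e)))%N)).
rewrite big_split /= -big_distrr /= -sr; apply: leq_add.
  by rewrite leq_mul2l sum_uniq_geq_bin2 ?orbT.
rewrite leq_subLR; apply: leq_trans (size_uniq_leq_sum (string_pt beta d (k d)) us) _.
rewrite [X in (X <= _)%N]addnC leq_add2l; apply: leq_sum => i _.
by rewrite (bigD1 d) //= leq_addr.
Qed.

End StringEnum.

(** * The q-adic order of string terms in the fraction field *)

Section Valuation.
Variable K : fieldType.
Local Notation q := (fps_q K).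
Local Notation L := {fraction (fps K)}.
Local Notation Q := (tofrac q : L).
Implicit Types (x y : L) (f g : fps K).

Definition inO M x := exists f, x = tofrac (q ^+ M * f).

Lemma inO_tofrac M f : inO M (tofrac f) <-> qdvd M f.
Proof. by split=> -[h]; [move/eqP; rewrite tofrac_eq => /eqP ->|move=> ->]; exists h. Qed.

Lemma inOM M N x y : inO M x -> inO N y -> inO (M + N) (x * y).
Proof. by move=> [f ->] [g ->]; exists (f * g); rewrite -rmorphM exprD mulrACA. Qed.

Lemma inOD M x y : inO M x -> inO M y -> inO M (x + y).
Proof. by move=> [f ->] [g ->]; exists (f + g); rewrite -rmorphD mulrDr. Qed.

Lemma inO0 M : inO M 0.
Proof. by exists 0; rewrite mulr0 rmorph0. Qed.

Lemma inO_tofrac0 f : inO 0 (tofrac f).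
Proof. by exists f; rewrite expr0 mul1r. Qed.

Lemma inO_sum M (I : Type) (s : seq I) (P : pred I) (F : I -> L) :
  (forall i, P i -> inO M (F i)) -> inO M (\sum_(i <- s | P i) F i).
Proof. by move=> HF; apply: (big_ind (inO M)) => //; [exact: inO0 | exact: inOD]. Qed.

Lemma inO_leq M N x : (M <= N)%N -> inO N x -> inO M x.
Proof. by move=> MN [f ->]; apply/inO_tofrac; apply: qdvd_leq MN _; exists f. Qed.

Lemma inO_prod (I : Type) (s : seq I) (P : pred I) (F : I -> L) (e : I -> nat) :
  (forall i, P i -> inO (e i) (F i)) ->
  inO (\sum_(i <- s | P i) e i) (\prod_(i <- s | P i) F i).
Proof.
move=> HF; apply: (big_ind2 (fun M x => inO M x)) => //.
  by rewrite -(rmorph1 (@tofrac (fps K))); exact: inO_tofrac0.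
by move=> ? ? ? ?; exact: inOM.
Qed.

Lemma inO_eq0 x : (forall M, inO M x) -> x = 0.
Proof.
move=> H; have [f xf] := H 0%N; rewrite xf in H *.
rewrite expr0 mul1r in H *; rewrite (@qdvd_eq _ f 0) ?rmorph0 // => M.
by rewrite subr0; apply/inO_tofrac.
Qed.

Lemma tofrac_q_neq0 : Q != 0.
Proof.
rewrite tofrac_eq0; apply/eqP => /(congr1 (fun f => fps_coef f 1)) /eqP.
by rewrite /= coefX oner_eq0.
Qed.

Lemma tofrac_q_expn_neq1 i : (0 < i)%N -> Q ^+ i != 1.
Proof.
move=> i0; rewrite -rmorphXn -(rmorph1 (@tofrac (fps K))) tofrac_eq.
apply/eqP => /(congr1 (fun f => fps_coef f 0)) /eqP.
by rewrite fps_coef0_qXn fps_coef1 (gtn_eqF i0) eq_sym oner_eq0.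
Qed.

(** For i < y the quotient is 1 / (1 - q^(y - i)), for i > y it is - q^(i - y) / (1 - q^(i - y));
    the truncated difference i - y is the exact order in both cases. *)
Lemma inO_ratio (i y : nat) : i != y -> inO (i - y) (Q ^+ i / (Q ^+ i - Q ^+ y)).
Proof.
have u j : (0 < j)%N -> (1 - q ^+ j) \is a GRing.unit.
  by move=> j0; rewrite fps_unitE fps_coefB fps_coef0_qXn fps_coef1 (gtn_eqF j0) subr0
    oner_eq0.
have v j : (0 < j)%N -> tofrac (1 - q ^+ j)^-1 = (1 - Q ^+ j)^-1 :> L.
  by move=> j0; rewrite rmorphV ?u // rmorphB rmorph1 rmorphXn.
have Q0 j : Q ^+ j != 0 by rewrite expf_neq0 // tofrac_q_neq0.
have Q1 j : (0 < j)%N -> 1 - Q ^+ j != 0.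
  by move=> j0; rewrite subr_eq0 eq_sym tofrac_q_expn_neq1.
rewrite neq_ltn => /orP[iy|yi].
  have -> : Q ^+ i / (Q ^+ i - Q ^+ y) = tofrac (1 - q ^+ (y - i))^-1.
    have e : Q ^+ y = Q ^+ i * Q ^+ (y - i) by rewrite -exprD subnKC 1?ltnW.
    have -> : Q ^+ i - Q ^+ y = Q ^+ i * (1 - Q ^+ (y - i)) by rewrite e; ring.
    by rewrite v ?subn_gt0 // invfM mulrA mulfV ?mul1r ?Q0 //.
  by apply: (@inO_leq _ 0); [lia | exact: inO_tofrac0].
exists (- (1 - q ^+ (i - y))^-1).
rewrite [RHS]rmorphM rmorphN /= (v (i - y)%N) ?subn_gt0 // rmorphXn.
have e : Q ^+ i = Q ^+ y * Q ^+ (i - y) by rewrite -exprD subnKC 1?ltnW.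
have -> : Q ^+ i - Q ^+ y = Q ^+ y * - (1 - Q ^+ (i - y)) by rewrite e; ring.
by rewrite e invfM invrN mulrACA mulfV ?mul1r ?Q0 //.
Qed.

Section Weights.
Variables (n beta : nat).
Hypotheses (le_n_beta : (n <= beta)%N) (beta_gt0 : (0 < beta)%N).
Implicit Types (k : 'I_n -> nat).
Local Notation pt := (string_pt beta).

Lemma inO_string_weight_sum m k :
  inO (\sum_c \sum_(a < k c) (m * pt c a + \sum_e (pt c a - pt e (k e))))
    (string_weight Q beta m k).
Proof.
apply: inO_prod => c _; apply: inO_prod => a _; apply: inOM.
  by rewrite -exprM -rmorphXn mulnC; apply/inO_tofrac/qdvd_qXn.
apply: inO_prod => e _; apply: inO_ratio; apply/eqP => /(string_pt_inj le_n_beta) [ce].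
by have := ltn_ord a; rewrite -ce => /[swap] ->; rewrite ltnn.
Qed.

Lemma inO_string_weight m k d r : (\sum_c k c)%N = r ->
  inO (m * 'C(r, 2) + (r - (pt d (k d)).+1)) (string_weight Q beta m k).
Proof.
move=> kr; apply: inO_leq (string_sum_bound le_n_beta m d kr) _.
exact: inO_string_weight_sum.
Qed.

(** Term and weight differ by a product of factors 1 - q^e, where e is the distance from a point of
    the segments to the end of a string of the alphabet. No such point exceeds beta (r + 1), so e >=
    M. *)
Lemma inO_string_term m k (B : 'I_n -> nat) M r : (\sum_c k c)%N = r ->
  (forall d, beta * r.+1 + M <= pt d (B d))%N ->
  inO M (string_term Q beta m B k - string_weight Q beta m k).
Proof.
move=> kr Bbig; have ptle c (a : 'I_(k c)) : (pt c a <= beta * r.+1)%N.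
  have : (k c <= r)%N by rewrite -kr (bigD1 c) //= leq_addr.
  by have := ltn_ord a; have := ltn_ord c; rewrite /string_pt; nia.
pose P : fps K := \prod_c \prod_(a < k c) \prod_d (1 - q ^+ (pt d (B d) - pt c a)).
have -> : string_term Q beta m B k = string_weight Q beta m k * tofrac P.
  rewrite rmorph_prod -big_split; apply: eq_bigr => c _ /=.
  rewrite rmorph_prod -big_split; apply: eq_bigr => a _ /=.
  rewrite rmorph_prod -mulrA -big_split /=; congr (_ * _); apply: eq_bigr => d _.
  rewrite rmorphB rmorph1 rmorphXn mulrAC; congr (_ / _).
  by rewrite mulrBr mulr1 -exprD subnKC // (leq_trans (ptle c a)) // (leq_trans _ (Bbig d))
    ?leq_addr.
rewrite -[X in _ - X]mulr1 -mulrBr -(rmorph1 (@tofrac (fps K))) -rmorphB.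
rewrite -[M]add0n; apply: inOM; first exact: inO_leq _ (inO_string_weight_sum m k).
apply/inO_tofrac; apply: qdvd_sub_prod1 => c _; apply: qdvd_sub_prod1 => a _;
  apply: qdvd_sub_prod1 => d _.
rewrite addrAC subrr add0r.
apply/qdvdN/qdvd_qXn; have := ptle c a; have := Bbig d; lia.
Qed.

Lemma rmorph_qpoch (R S : comNzRingType) (f : {rmorphism R -> S}) (a x : R) j :
  f (qpoch a x j) = qpoch (f a) (f x) j.
Proof.
by rewrite rmorph_prod; apply: eq_bigr => i _; rewrite rmorphB rmorph1 rmorphM rmorphXn.
Qed.

Lemma rmorph_string_den (R S : comNzRingType) (f : {rmorphism R -> S}) (x : R) k :
  f (string_den beta x k) = string_den beta (f x) k.
Proof.
rewrite rmorphM !rmorph_prod; congr (_ * _).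
  by apply: eq_bigr => c _; rewrite rmorph_qpoch !rmorphXn.
apply: eq_bigr => c _; rewrite rmorph_prod; apply: eq_bigr => d _.
by rewrite rmorphM !rmorph_qpoch !rmorphXn.
Qed.

Definition string_den_inf : fps K :=
  qpoch_inf (q ^+ beta) (q ^+ beta) ^+ n *
  \prod_(c < n) \prod_(d < n | (c < d)%N) theta_q K (d - c) beta.

Lemma qdvd_string_den k M : (forall c, M <= k c)%N ->
  qdvd M (string_den_inf - string_den beta q k).
Proof.
move=> Mk; have step (a : fps K) j : (M <= j)%N ->
    qdvd M (qpoch_inf a (q ^+ beta) - qpoch a (q ^+ beta) j).
  by move=> Mj; apply/qdvd_subC/(qdvd_leq Mj)/qdvd_qpoch.
apply: qdvd_subM.
  rewrite -[X in _ ^+ X]card_ord -prodr_const.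
  by apply: qdvd_sub_prod => c _; apply: step.
apply: qdvd_sub_prod => c _; apply: qdvd_sub_prod => d _.
by apply: qdvd_subM; apply: step => //; apply: leqW.
Qed.

(** If every string has at least M points, Den(k) agrees with its limit modulo q^M and the weight
    supplies m C(r, 2). If string d has fewer, Den(k) may be far from the limit, but the order of
    the weight grows by r - (pt d (k d) + 1), which the bound on r makes at least M. *)
Lemma inO_num_defect m k M r : (\sum_c k c)%N = r -> (M + beta * M.+1 <= r)%N ->
  inO (m * 'C(r, 2) + M)
    (string_weight Q beta m k * (tofrac string_den_inf - string_den beta Q k)).
Proof.
move=> kr rbig; rewrite -(rmorph_string_den (@tofrac (fps K))) -rmorphB.
case: (pselect (forall c, M <= k c)%N) => [Mk|/existsNP [d /negP]].
  apply: inOM; last exact/inO_tofrac/qdvd_string_den.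
  have [n0|n0] := posnP n.
    by move: kr; rewrite big1 => [|c _]; [lia | have := ltn_ord c; lia].
  by apply: inO_leq _ (inO_string_weight m (Ordinal n0) kr); rewrite leq_addr.
rewrite -ltnNge => kd; rewrite -[X in inO X]addn0; apply: inOM; last exact: inO_tofrac0.
apply: inO_leq _ (inO_string_weight m d kr); rewrite leq_add2l.
by have := ltn_ord d; rewrite /string_pt; nia.
Qed.

End Weights.
End Valuation.

Lemma hl_vfact_neq0 (K : fieldType) (t : K) : (forall i, (0 < i)%N -> t ^+ i != 1) ->
  forall k, hl_vfact t k != 0.
Proof.
move=> t1 k; apply: mulf_neq0.
  by apply/prodf_neq0 => i _; rewrite -exprS subr_eq0 eq_sym t1.
by rewrite invr_eq0 expf_neq0 // subr_eq0 eq_sym -[t]expr1 t1.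
Qed.

(** Both sides are the subset form of one and the same symmetrisation, which replaces a reindexing
    of subsets along [f]. *)
Lemma hl_subset_sum_imset (K : fieldType) (T : finType) (x : T -> K) (t : K) N
    (f : 'I_N -> T) r m :
  injective x -> (forall a, x a != 0) -> (forall i, (0 < i)%N -> t ^+ i != 1) ->
  injective f -> (r <= N)%N -> (0 < m)%N ->
  hl_subset_sum (fun i => x (f i)) t setT r m = hl_subset_sum x t (f @: setT) r m.
Proof.
move=> x_inj x0 t1 f_inj rN m0; have t_neq1 : t != 1 by rewrite -[t]expr1 t1.
have v0 := hl_vfact_neq0 t1; have xf_inj : injective (fun i => x (f i)).
  by move=> i j /x_inj /f_inj.
rewrite -(hl_symmetrization_subset_sum x_inj x0 t_neq1 f_inj rN m0 v0).
rewrite -[in LHS](imset_id setT).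
by rewrite -(hl_symmetrization_subset_sum (f := id) xf_inj (fun i => x0 (f i)) t_neq1 _ rN
  m0 v0).
Qed.

(** * Evaluation of the comparison sum *)

Section SubsetCount.
Variables (K : fieldType) (n beta r : nat).
Hypotheses (le_n_beta : (n <= beta)%N) (n_gt0 : (0 < n)%N).
Local Notation q := (fps_q K).
Local Notation Q := (tofrac q).

(** For strings of finite length the sum is the t-binomial coefficient of N over r with t = q^beta,
    by [hl_subset_sum_m0]; it tends to 1 / (t; t)_r as the strings grow. The exact identity follows
    by proving it modulo every q^M. *)
Lemma sum_string_weight0 :
  qpoch (Q ^+ beta) (Q ^+ beta) r *
  \sum_(k : {ffun 'I_n -> 'I_r.+1} | compositions k) string_weight Q beta 0 (fun c => k c)
    = 1.
Proof.
have b0 : (0 < beta)%N := leq_trans n_gt0 le_n_beta.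
have Q0 := tofrac_q_neq0 K; have Q1 := @tofrac_q_expn_neq1 K.
apply: subr0_eq; apply: inO_eq0 => M.
(* The first two summands bring the terms within q^M of the weights; the last one gives r <= N and N
   - r >= M. *)
pose B := (beta * r.+1 + M + r)%N; pose T := ('I_n * 'I_B)%type; pose N := #|{: T}|.
have NE : N = (n * B)%N by rewrite /N card_prod !card_ord.
have BN : (B <= N)%N by rewrite NE leq_pmull.
have rN : (r <= N)%N by apply: leq_trans BN; rewrite /B leq_addl.
pose t := Q ^+ beta; have t1 i : (0 < i)%N -> t ^+ i != 1.
  by move=> i0; rewrite -exprM Q1 // muln_gt0 b0.
have t_neq1 : t != 1 by rewrite -[t]expr1 t1.
pose S := \sum_(k : {ffun 'I_n -> 'I_r.+1} | compositions k)
  string_term Q beta 0 (fun=> B) (fun c => k c).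
(* The quotient (t; t)_N / (t; t)_(N - r), which is 1 modulo q^M. *)
pose P : fps K := \prod_(i < r) (1 - q ^+ (beta * (N - r + i).+1)).
have PE : qpoch t t r * S = tofrac P.
  have : hl_vfact t r * hl_vfact t (N - r) * S = hl_vfact t N.
    rewrite /S -(hl_subset_sum_string Q0 Q1 le_n_beta r 0 (fun=> leqnn B)).
    have <- : @enum_val T predT @: setT = [set p : T | (p.2 < B)%N].
      apply/setP => p; rewrite inE ltn_ord; apply/imsetP.
      by exists (enum_rank p); rewrite ?enum_rankK.
    exact: (hl_subset_sum_m0 (string_val_inj Q0 Q1 le_n_beta (M := B))
      (string_val_neq0 beta Q0 (M := B)) t_neq1 (@enum_val_inj T predT) rN).
  have -> : hl_vfact t N = hl_vfact t (N - r + r) by rewrite subnK.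
  rewrite /hl_vfact.
  have -> : qpoch t t (N - r + r) = qpoch t t (N - r) * tofrac P.
    rewrite {1}/qpoch big_split_ord /= rmorph_prod; congr (_ * _); apply: eq_bigr => i _.
    by rewrite rmorphB rmorph1 rmorphXn -exprS exprM.
  have u : (1 - t) != 0 by rewrite subr_eq0 eq_sym.
  have v : qpoch t t (N - r) != 0.
    by apply/prodf_neq0 => i _; rewrite -exprS subr_eq0 eq_sym t1.
  rewrite exprD => e; apply: (mulfI v).
  have w j : (1 - t) ^+ j != 0 by exact: expf_neq0.
  have : qpoch t t (N - r) * (qpoch t t r * S) / ((1 - t) ^+ (N - r) * (1 - t) ^+ r) =
     qpoch t t (N - r) * tofrac P / ((1 - t) ^+ (N - r) * (1 - t) ^+ r).
    by rewrite -e invfM; ring.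
  by move/(mulIf _); apply; rewrite invr_eq0 mulf_neq0.
have SE : inO M (S - \sum_(k : {ffun 'I_n -> 'I_r.+1} | compositions k)
    string_weight Q beta 0 (fun c => k c)).
  rewrite -sumrB; apply: inO_sum => k /eqP kr; apply: (@inO_string_term K n beta le_n_beta
    b0 0 (fun c => k c) (fun=> B) M r kr) => d.
  by rewrite /string_pt /B; nia.
rewrite -/t; set W := \sum_(k | _) _ in SE *.
have -> : qpoch t t r * W - 1 = tofrac (P - 1) - qpoch t t r * (S - W).
  rewrite rmorphB rmorph1 [X in _ = X - 1 - _](_ : _ = tofrac P) // -PE; ring.
apply: inOD.
  apply/inO_tofrac/qdvd_sub_prod1 => i _; rewrite addrAC subrr add0r.
  by apply/qdvdN/qdvd_qXn; move: BN; rewrite /B; nia.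
rewrite -mulN1r mulrA -[M]add0n; apply: inOM SE.
exists (- qpoch (q ^+ beta) (q ^+ beta) r).
by rewrite expr0 mul1r rmorphN rmorph_qpoch rmorphXn mulN1r.
Qed.

End SubsetCount.

(** * Polynomiality and specialisation *)

Section HlNumerator.
Variables (N r m : nat).

Definition vdm_prod (R : comNzRingType) (y : 'I_N -> R) : R :=
  \prod_(i < N) \prod_(j < N | (i < j)%N) (y j - y i).

(* vdm_prod y divided by the product of the y_i - y_j for i in I and j outside I. *)
Definition hl_cofactor (R : comNzRingType) (y : 'I_N -> R) (I : {set 'I_N}) : R :=
  \prod_(i < N) \prod_(j < N | (i < j)%N)
    (if (i \in I) == (j \in I) then y j - y i else if i \in I then - 1 else 1).

(** The symmetrisation of (m^r) times the Vandermonde product, with denominators cleared: a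
    polynomial expression, hence compatible with ring morphisms. *)
Definition hl_num (R : comNzRingType) (y : 'I_N -> R) (t : R) : R :=
  \sum_(I : {set 'I_N} | #|I| == r)
    \prod_(i in I) y i ^+ m * \prod_(i in I) \prod_(j in ~: I) (y i - t * y j) *
    hl_cofactor y I.

Lemma hl_num_field (K : fieldType) (y : 'I_N -> K) t : injective y ->
  hl_num y t = vdm_prod y * hl_subset_sum y t [set: 'I_N] r m.
Proof.
move=> y_inj; rewrite /hl_subset_sum mulr_sumr.
apply: eq_big => [I|I _]; first by rewrite subsetT.
have -> : vdm_prod y = hl_cofactor y I * \prod_(i in I) \prod_(j in ~: I) (y i - y j).
  pose G i j := if (i \in I) && (j \notin I) then y i - y j else 1.
  have -> : \prod_(i in I) \prod_(j in ~: I) (y i - y j) = \prod_i \prod_j G i j.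
    rewrite big_mkcond; apply: eq_bigr => i _; rewrite /G; case: (i \in I);
      last by rewrite big1.
    by rewrite big_mkcond; apply: eq_bigr => j _; rewrite inE.
  rewrite big_lt_gt /= big1 ?mul1r; last by move=> i _; rewrite /G andbN.
  rewrite -big_split; apply: eq_bigr => i _; rewrite -big_split; apply: eq_bigr => j _ /=.
  by rewrite /G; case: (i \in I); case: (j \in I) => /=; ring.
rewrite /hl_subset_term setTD.
have -> : \prod_(i in I) \prod_(j in ~: I) (y i - t * y j) =
    \prod_(i in I) \prod_(j in ~: I) (y i - y j) *
    \prod_(i in I) \prod_(j in ~: I) hl_ratio y t i j.
  rewrite -big_split; apply: eq_bigr => i iI; rewrite -big_split; apply: eq_bigr => j jI /=.
  rewrite /hl_ratio [RHS]mulrC divfK // subr_eq0 (inj_eq y_inj).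
  by apply: contraTneq jI => <-; rewrite inE iI.
ring.
Qed.

Lemma rmorph_vdm_prod (R S : comNzRingType) (f : {rmorphism R -> S}) (y : 'I_N -> R) :
  f (vdm_prod y) = vdm_prod (fun i => f (y i)).
Proof.
rewrite rmorph_prod; apply: eq_bigr => i _; rewrite rmorph_prod.
by apply: eq_bigr => j _; rewrite rmorphB.
Qed.

Lemma rmorph_hl_num (R S : comNzRingType) (f : {rmorphism R -> S}) (y : 'I_N -> R) t :
  f (hl_num y t) = hl_num (fun i => f (y i)) (f t).
Proof.
rewrite rmorph_sum; apply: eq_bigr => I _; rewrite !rmorphM; congr (_ * _ * _).
- by rewrite rmorph_prod; apply: eq_bigr => i _; rewrite rmorphXn.
- rewrite rmorph_prod; apply: eq_bigr => i _; rewrite rmorph_prod.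
  by apply: eq_bigr => j _; rewrite rmorphB rmorphM.
- rewrite rmorph_prod; apply: eq_bigr => i _; rewrite rmorph_prod.
  apply: eq_bigr => j _; case: eqP => _; first by rewrite rmorphB.
  by case: (i \in I); rewrite ?rmorphN rmorph1.
Qed.

Lemma vdm_prod_perm (R : comNzRingType) (y : 'I_N -> R) (s : 'S_N) :
  vdm_prod (fun i => y (s i)) = (-1) ^+ s * vdm_prod y.
Proof.
have vdmE (z : 'I_N -> R) : vdm_prod z = \det (Vandermonde N (\row_j z j)).
  by rewrite det_Vandermonde; apply: eq_bigr => i _; apply: eq_bigr => j _; rewrite !mxE.
rewrite !vdmE (_ : Vandermonde N (\row_j y (s j)) = col_perm s (Vandermonde N (\row_j y
  j))).
  by rewrite col_permE det_mulmx det_perm odd_permV mulrC.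
by apply/matrixP => i j; rewrite !mxE.
Qed.

Lemma vdm_prod_neq0 (R : idomainType) (y : 'I_N -> R) : injective y -> vdm_prod y != 0.
Proof.
move=> y_inj; apply/prodf_neq0 => i _; apply/prodf_neq0 => j ij.
by rewrite subr_eq0 (inj_eq y_inj) -val_eqE /= gtn_eqF.
Qed.

(** The subset sum is symmetric and the Vandermonde product alternating. *)
Lemma hl_num_perm (K : fieldType) (y : 'I_N -> K) t (s : 'S_N) : injective y ->
  (forall i, y i != 0) -> (forall i, (0 < i)%N -> t ^+ i != 1) ->
  (r <= N)%N -> (0 < m)%N ->
  hl_num (fun i => y (s i)) t = (-1) ^+ s * hl_num y t.
Proof.
move=> y_inj y0 t1 rN m0; rewrite !hl_num_field //; last by move=> i j /y_inj /perm_inj.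
rewrite vdm_prod_perm (hl_subset_sum_imset y_inj y0 t1 (@perm_inj _ s) rN m0) mulrA.
congr (_ * hl_subset_sum _ _ _ _ _); apply/setP => i; rewrite inE.
by apply/imsetP; exists (s^-1%g i); rewrite ?permKV.
Qed.

End HlNumerator.

(** * Divisibility by the Vandermonde product *)

Section MpolyVandermonde.
Variables (R : idomainType) (N : nat).
Implicit Types (P : {mpoly R[N]}).

Definition merge_var (a b : 'I_N) (i : 'I_N) : 'I_N := if i == a then b else i.

Definition mpoly_merge (a b : 'I_N) : {mpoly R[N]} -> {mpoly R[N]} :=
  mmap (@mpolyC N R) (fun i => 'X_(merge_var a b i)).

HB.instance Definition _ a b := GRing.RMorphism.on (mpoly_merge a b).

Lemma mpoly_mergeX a b i : mpoly_merge a b 'X_i = 'X_(merge_var a b i).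
Proof. by rewrite /mpoly_merge mmapX mmap1U. Qed.

Lemma mpoly_merge_hl_num r m a b (y : 'I_N -> {mpoly R[N]}) t :
  mpoly_merge a b (hl_num r m y t) =
  hl_num r m (fun i => mpoly_merge a b (y i)) (mpoly_merge a b t).
Proof. exact: (rmorph_hl_num r m (mpoly_merge a b)). Qed.

Lemma mpolyX_inj : injective (fun i : 'I_N => 'X_i : {mpoly R[N]}).
Proof.
move=> i j /(congr1 (fun P => P@_U_(j))); rewrite !mcoeffXU eqxx.
by case: eqVneq => // _ /eqP; rewrite eq_sym oner_eq0.
Qed.

(** The decomposition passes to sums and products and holds for constants and variables, which
    generate the ring. *)
Lemma mpoly_merge_sub a b P : exists Q, P = mpoly_merge a b P + ('X_b - 'X_a) * Q.
Proof.
pose D P := exists Q, P = mpoly_merge a b P + ('X_b - 'X_a) * Q.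
have D1 P1 P2 : D P1 -> D P2 -> D (P1 + P2).
  by move=> [Q1 e1] [Q2 e2]; exists (Q1 + Q2); rewrite rmorphD {1}e1 {1}e2; ring.
have D2 P1 P2 : D P1 -> D P2 -> D (P1 * P2).
  move=> [Q1 e1] [Q2 e2]; exists (Q1 * P2 + mpoly_merge a b P1 * Q2).
  by rewrite rmorphM {1}e1 mulrDl {1}e2; ring.
have DC c : D c%:MP by exists 0; rewrite /mpoly_merge mmapC mulr0 addr0.
have DX i : D 'X_i.
  rewrite /D mpoly_mergeX /merge_var; case: eqVneq => [->|_]; last by exists 0;
    rewrite mulr0 addr0.
  by exists (-1); ring.
rewrite -/(D P) (mpolyE P); apply: (big_ind D) => [||mm _];
  [by rewrite -mpolyC0 | exact: D1 |].
rewrite -mul_mpolyC; apply: (D2) => //; rewrite mpolyXE_id.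
apply: (big_ind D) => [||i _]; [by rewrite -mpolyC1 | exact: D2 |].
by elim: (mm i) => [|e IH]; rewrite ?expr0 -?mpolyC1 // exprS; apply: (D2).
Qed.

(** One factor is divided out at a time. Merging c < d does not kill X_b - X_a for another pair a <
    b, so in a domain the quotient still vanishes under the remaining merges. *)
Lemma prod_sub_dvd_mpoly (s : seq ('I_N * 'I_N)) P : uniq s ->
  (forall u, u \in s -> (u.1 < u.2)%N /\ mpoly_merge u.1 u.2 P = 0) ->
  exists Q, P = \prod_(u <- s) ('X_u.2 - 'X_u.1) * Q.
Proof.
elim: s P => [|[a b] s IH] P /=; first by exists P; rewrite big_nil mul1r.
move=> /andP[ab_s us] sP; have [Q] := mpoly_merge_sub a b P.
have [/= ab ->] := sP (a, b) (mem_head _ _); rewrite add0r => PE.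
have [|Q' QE] := IH Q us; last by exists Q'; rewrite big_cons PE {1}QE mulrA.
move=> [c d] cd_s; have [/= cd P0] := sP (c, d) (mem_behead (s := _ :: s) cd_s);
  split=> //=.
have : mpoly_merge c d (('X_b - 'X_a) * Q) = 0 by rewrite -PE.
rewrite rmorphM rmorphB /= !mpoly_mergeX => /eqP; rewrite mulf_eq0 => /orP[|/eqP //].
rewrite subr_eq0 => /eqP/mpolyX_inj; rewrite /merge_var => e; case/negP: ab_s.
suff [-> ->] : a = c /\ b = d by [].
move: e; case: eqP => [bc|_]; case: eqP => [ac|_] e; move: ab cd.
- by rewrite bc ac ltnn.
- by rewrite bc -e => /ltnW; rewrite leqNgt => /negbTE ->.
- by rewrite ac -e.
- by rewrite e ltnn.
Qed.

End MpolyVandermonde.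

Section Polynomiality.
Variables (R : idomainType) (u : R) (N r m : nat).
Hypotheses (u_neq1 : forall i, (0 < i)%N -> u ^+ i != 1) (two_neq0 : (2%:R : R) != 0).
Hypotheses (le_rN : (r <= N)%N) (m_gt0 : (0 < m)%N).
Local Notation MP := {mpoly R[N]}.
Local Notation X := (fun i : 'I_N => 'X_i : MP).
Local Notation T := (u%:MP_[N] : MP).
Local Notation XF := (fun i : 'I_N => tofrac ('X_i : MP)).
Local Notation TF := (tofrac T).

Lemma tofracX_inj : injective XF.
Proof. by move=> i j /eqP; rewrite tofrac_eq => /eqP /mpolyX_inj. Qed.

Lemma tofracX_neq0 i : XF i != 0.
Proof.
rewrite tofrac_eq0; apply/eqP => /(congr1 (fun P => P@_U_(i))) /eqP.
by rewrite mcoeffXU eqxx mcoeff0 oner_eq0.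
Qed.

Lemma tofracT_neq1 i : (0 < i)%N -> TF ^+ i != 1.
Proof.
move=> i0; rewrite -rmorphXn -(rmorph1 (@tofrac MP)) tofrac_eq -rmorphXn -mpolyC1 mpolyC_eq.
exact: u_neq1.
Qed.

(* Exchanging two variables changes the sign of the numerator, which therefore
   vanishes once they are made equal. *)
Lemma hl_num_merge (a b : 'I_N) : a != b -> mpoly_merge a b (hl_num r m X T) = 0.
Proof.
move=> ab; have swap : hl_num r m (fun i => X (tperm a b i)) T = - hl_num r m X T.
  apply/eqP; rewrite -tofrac_eq rmorphN !rmorph_hl_num /=.
  rewrite (hl_num_perm (tperm a b) tofracX_inj tofracX_neq0 tofracT_neq1 le_rN m_gt0).
  by rewrite odd_tperm ab mulN1r.
have : mpoly_merge a b (hl_num r m (fun i => X (tperm a b i)) T) =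
    mpoly_merge a b (hl_num r m X T).
  have e : (fun i => mpoly_merge a b (X (tperm a b i))) = (fun i => mpoly_merge a b (X i)).
    apply/funext => i; rewrite !mpoly_mergeX /merge_var.
    by case: tpermP => [->|->|//]; rewrite eqxx //; case: eqP.
  have := mpoly_merge_hl_num r m a b (fun i => X (tperm a b i)) T.
  rewrite e => ->; exact: esym (mpoly_merge_hl_num r m a b X T).
rewrite swap rmorphN => /eqP; rewrite -subr_eq0 -opprD oppr_eq0.
set P := mpoly_merge a b _; rewrite -mulr2n -mulr_natl mulf_eq0 => /orP[|/eqP //].
by rewrite -(rmorph_nat (@mpolyC N R)) mpolyC_eq0 (negPf two_neq0).
Qed.

Lemma vdm_prod_dvd_hl_num : exists P, hl_num r m X T = vdm_prod X * P.
Proof.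
pose s := [seq v : 'I_N * 'I_N <- enum {: 'I_N * 'I_N} | (v.1 < v.2)%N].
have [||P ->] := @prod_sub_dvd_mpoly _ N s (hl_num r m X T).
- by rewrite filter_uniq // enum_uniq.
- move=> [a b]; rewrite mem_filter /= => /andP[ab _]; split=> //.
  by apply: hl_num_merge; rewrite -val_eqE /= ltn_eqF.
exists P; congr (_ * _); rewrite /vdm_prod pair_big_dep /= big_filter big_enum_cond /=.
by apply: eq_bigl => v.
Qed.

Lemma tofrac_hl_num :
  tofrac (hl_num r m X T) = vdm_prod XF * hl_symmetrization (nseq r m) XF TF.
Proof.
have T1 := tofracT_neq1; have TF1 : TF != 1 by rewrite -[TF]expr1 T1.
have := hl_symmetrization_subset_sum (f := id) tofracX_inj tofracX_neq0 TF1
  (fun _ _ => id) le_rN m_gt0 (hl_vfact_neq0 T1).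
rewrite imset_id => ->.
by rewrite rmorph_hl_num hl_num_field //; exact: tofracX_inj.
Qed.

Lemma hl_symmetrization_polynomial :
  exists P : MP, tofrac P = hl_symmetrization (nseq r m) XF TF.
Proof.
have [P PE] := vdm_prod_dvd_hl_num; exists P.
apply: (mulfI (vdm_prod_neq0 tofracX_inj)); rewrite -tofrac_hl_num PE rmorphM.
by rewrite rmorph_vdm_prod.
Qed.

(** [g] need not extend to the fraction field, as it may kill denominators. It is applied to the
    polynomial identity between [hl_num] and the Vandermonde product times [P]; the Vandermonde
    factor stays nonzero at distinct values and can be cancelled. *)
Lemma hl_symmetrization_specialise (L : fieldType) (g : {rmorphism MP -> L}) (P : MP) :
  tofrac P = hl_symmetrization (nseq r m) XF TF -> injective (fun i => g (X i)) ->
  g P = hl_subset_sum (fun i => g (X i)) (g T) [set: 'I_N] r m.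
Proof.
move=> PE g_inj; have : vdm_prod X * P = hl_num r m X T.
  by apply/eqP; rewrite -tofrac_eq tofrac_hl_num rmorphM /= PE rmorph_vdm_prod.
move/(congr1 g); rewrite rmorphM rmorph_vdm_prod rmorph_hl_num hl_num_field //.
by move/mulfI; apply; exact: vdm_prod_neq0.
Qed.

End Polynomiality.

Section Specialisation.
Variables (N r m n : nat).
Hypotheses (le_rN : (r <= N)%N) (m_gt0 : (0 < m)%N) (n_gt0 : (0 < n)%N).
Local Notation MP := {mpoly {poly rat}[N]}.

Lemma polyX_expn_neq1 i : (0 < i)%N -> 'X ^+ i != 1 :> {poly rat}.
Proof.
move=> i0; apply/eqP => /(congr1 (fun p : {poly rat} => p`_0)) /eqP.
by rewrite coefXn coef1 (ltn_eqF i0) eq_sym oner_eq0.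
Qed.

Lemma polyrat_two_neq0 : (2%:R : {poly rat}) != 0.
Proof. by rewrite -polyC_natr polyC_eq0. Qed.

(** Since the symmetrisation is a polynomial, [xget] does not return its default value. *)
Lemma tofrac_hl_poly :
  tofrac (hl_poly (nseq r m) N) =
  hl_symmetrization (nseq r m) (fun i : 'I_N => tofrac 'X_i)
    (tofrac (('X : {poly rat})%:MP_[N])).
Proof.
have len : partn_length (nseq r m) = r by rewrite /partn_length count_nseq m_gt0 mul1n.
rewrite /hl_poly len le_rN; case: classical_sets.xgetP => [P _ ->//|noP].
have [P PE] := hl_symmetrization_polynomial polyX_expn_neq1 polyrat_two_neq0 le_rN m_gt0.
by case: (noP P).
Qed.

Definition spec_mor : MP -> {poly rat} := mmap (comp_poly 'X^n) (fun i : 'I_N => 'X^i).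

HB.instance Definition _ := GRing.RMorphism.on spec_mor.

Local Notation q := (fps_q rat).
Local Notation Q := (tofrac q).

Lemma hl_spec_subset_sum :
  tofrac (fps_of_poly (hl_spec (nseq r m) n N)) =
  hl_subset_sum (fun i : 'I_N => Q ^+ i) (Q ^+ n) [set: 'I_N] r m.
Proof.
have Q_inj : injective (fun i : 'I_N => Q ^+ i).
  by move=> i j /(q_expn_inj (tofrac_q_neq0 _) (@tofrac_q_expn_neq1 _)) /val_inj.
pose g : {rmorphism MP -> {fraction (fps rat)}} :=
  (@tofrac (fps rat) \o (@fps_of_poly rat \o spec_mor))%FUN.
have gX (i : 'I_N) : g 'X_i = Q ^+ i.
  by rewrite /g /= /spec_mor mmapX mmap1U rmorphXn /= rmorphXn.
have gT : g (('X : {poly rat})%:MP_[N]) = Q ^+ n.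
  by rewrite /g /= /spec_mor mmapC /= comp_polyX rmorphXn /= rmorphXn.
have gXE : (fun i : 'I_N => g 'X_i) = (fun i : 'I_N => Q ^+ i) by apply/funext.
rewrite -gT -gXE.
have g_inj : injective (fun i : 'I_N => g 'X_i) by rewrite gXE.
exact: (hl_symmetrization_specialise polyX_expn_neq1 le_rN m_gt0
  (g := g) tofrac_hl_poly g_inj).
Qed.

(* The number of i < N with i = d modulo n. *)
Definition string_len (d : 'I_n) : nat := ((N - d + n.-1) %/ n)%N.

Lemma string_len_ltn (d : 'I_n) b : (b < string_len d)%N = (string_pt n d b < N)%N.
Proof.
clear le_rN m_gt0; rewrite /string_len /string_pt leq_divRL //.
by have := ltn_ord d; rewrite mulnC; lia.
Qed.

Lemma hl_spec_string :
  tofrac (fps_of_poly (hl_spec (nseq r m) n N)) =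
  \sum_(k : {ffun 'I_n -> 'I_r.+1} | compositions k)
    string_term Q n m string_len (fun c => k c).
Proof.
have Q0 := tofrac_q_neq0 rat; have Q1 := @tofrac_q_expn_neq1 rat.
have len_le d : (string_len d <= N)%N.
  rewrite leqNgt string_len_ltn /string_pt -leqNgt.
  by apply: leq_trans (leq_addl _ _); rewrite leq_pmull.
rewrite hl_spec_subset_sum -(hl_subset_sum_string Q0 Q1 (leqnn n) r m len_le).
have ltd (i : 'I_N) : (i %/ n < N)%N by apply: leq_ltn_trans (leq_div _ _) _.
(* Division with remainder: variable i sits on string i mod n at place i / n. *)
pose f (i : 'I_N) : 'I_n * 'I_N := (Ordinal (ltn_pmod i n_gt0), Ordinal (ltd i)).
have fE i : string_val Q n (f i) = Q ^+ i.
  by rewrite /string_val /string_pt /= addnC mulnC -divn_eq.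
have f_inj : injective f.
  move=> i j /(congr1 (fun p : 'I_n * 'I_N => (p.2 * n + p.1)%N)) /=; rewrite -!divn_eq;
    exact: val_inj.
have -> : [set p : 'I_n * 'I_N | (p.2 < string_len p.1)%N] = f @: [set: 'I_N].
  apply/setP => -[c b]; rewrite inE /= string_len_ltn;
    apply/idP/imsetP => [lt|[i _ [-> ->]]].
    exists (Ordinal lt); rewrite ?inE //; apply/eqP; rewrite xpair_eqE -!val_eqE /=.
    by rewrite /string_pt addnC mulnC modnMDl modn_small // divnMDl // divn_small // addn0
      !eqxx.
  by rewrite /string_pt /= addnC mulnC -divn_eq.
rewrite -(hl_subset_sum_imset (string_val_inj Q0 Q1 (leqnn n) (M := N))) //.
- by congr (hl_subset_sum _ _ _ _ _); apply/funext => i; rewrite fE.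
- by move=> p; exact: string_val_neq0.
- by move=> i i0; rewrite -exprM Q1 // muln_gt0 n_gt0.
Qed.

End Specialisation.

(** * Product identities *)

Section ProductIdentities.
Local Notation q := (fps_q rat).

(** The difference j + 1 occurs n - (j + 1) times; truncated subtraction gives exponent 0 once j >=
    n. *)
Lemma prod_ord_diff (R : comNzRingType) (g : nat -> R) n K : (n <= K.+1)%N ->
  \prod_(c < n) \prod_(d < n | (c < d)%N) g (d - c)%N = \prod_(j < K) g j.+1 ^+ (n - j.+1).
Proof.
elim: n => [|n IH] nK; first by rewrite big_ord0 big1.
rewrite (prod_ord_gt0S (fun c d => g (d - c)%N)).
have -> : \prod_(j < K) g j.+1 ^+ (n.+1 - j.+1) =
    \prod_(j < n) g j.+1 * \prod_(j < K) g j.+1 ^+ (n - j.+1).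
  rewrite (big_ord_widen K (fun j => g j.+1)) // [X in X * _]big_mkcond -big_split.
  apply: eq_bigr => j _ /=; case: ltnP => jn; last by rewrite mul1r; congr (_ ^+ _); lia.
  by rewrite -exprS; congr (_ ^+ _); lia.
by rewrite -IH 1?ltnW.
Qed.

(** The theta function at s involves the classes s and K + 1 - s; reversing the product over the
    second one collects both exponents at the same class. *)
Lemma prod_theta n K : (n <= K.+1)%N ->
  \prod_(c < n) \prod_(d < n | (c < d)%N) theta_q rat (d - c) K.+1 =
  \prod_(j < K) qpoch_inf (q ^+ j.+1) (q ^+ K.+1) ^+ (n - j.+1 + (n - (K - j))).
Proof.
move=> nK; rewrite (prod_ord_diff (fun s => theta_q rat s K.+1) nK).
under eq_bigr do rewrite /theta_q exprMn.
rewrite big_split /= [X in _ * X](reindex_inj rev_ord_inj) /= -big_split.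
apply: eq_bigr => j _ /=; have jK := ltn_ord j;
  rewrite (_ : K.+1 - (K - j.+1).+1 = j.+1)%N; last by lia.
by rewrite -exprD (_ : (K - j.+1).+1 = K - j)%N //; lia.
Qed.

Lemma qpoch_inf_qq K :
  qpoch_inf q q = \prod_(j < K) qpoch_inf (q ^+ j.+1) (q ^+ K.+1) * qpoch_inf (q ^+ K.+1)
    (q ^+ K.+1).
Proof.
have := qpoch_inf_split rat 1 (ltn0Sn 0) (ltn0Sn K); rewrite expr1 => ->.
under eq_bigr do rewrite !mul1n add1n.
exact: big_ord_recr.
Qed.

Lemma theta_product_ord n kappa :
  theta_product n kappa =
  qpoch_inf (q ^+ kappa) (q ^+ kappa) ^+ (n - 1) / qpoch_inf q q ^+ n *
  \prod_(c < n) \prod_(d < n | (c < d)%N) theta_q rat (d - c) kappa.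
Proof.
rewrite /theta_product; congr (_ * _); rewrite big_add1 big_mkord /=.
by apply: eq_bigr => c _; rewrite big_add1 big_geq_mkord.
Qed.

Lemma qpoch_inf_qq_unit : qpoch_inf q q \is a GRing.unit.
Proof. by rewrite -[q]expr1; apply: qpoch_inf_unit. Qed.

(** When the modulus is n, the exponents n - s and s of [prod_theta] add up to n, so all classes
    modulo n occur equally often. *)
Lemma string_den_inf_same n : (0 < n)%N -> string_den_inf rat n n = qpoch_inf q q ^+ n.
Proof.
case: n => // n _; rewrite /string_den_inf prod_theta // (qpoch_inf_qq n) exprMn mulrC.
congr (_ * _); rewrite -prodrXl; apply: eq_bigr => j _; congr (_ ^+ _).
by have := ltn_ord j; lia.
Qed.

Lemma div_expn_cancel (R : comUnitRingType) (P V Th : R) n : V \is a GRing.unit -> (0 <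
  n)%N ->
  P ^+ (n - 1) / V * Th * (V * P) = P ^+ n * Th.
Proof.
move=> uV n0; have -> : P ^+ n = P ^+ (n - 1) * P by rewrite -exprSr subn1 prednK.
transitivity (P ^+ (n - 1) * (V^-1 * V) * Th * P); last by rewrite mulVr // mulr1 mulrAC.
by set H := P ^+ _; ring.
Qed.

Lemma theta_product_den_inf n kappa : (0 < n)%N -> (0 < kappa)%N ->
  theta_product n kappa * (string_den_inf rat n n * qpoch_inf (q ^+ kappa) (q ^+ kappa)) =
  string_den_inf rat n kappa.
Proof.
move=> n0 k0; rewrite string_den_inf_same // theta_product_ord /string_den_inf.
by apply: div_expn_cancel => //; rewrite unitrX // qpoch_inf_qq_unit.
Qed.

Lemma div_expn_cancel_prod (R : comUnitRingType) (P V Th : R) K (F : 'I_K -> R) n :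
  V = \prod_j F j * P -> V \is a GRing.unit -> (0 < n)%N ->
  P ^+ (n - 1) / V ^+ n * Th * P * \prod_j F j ^+ n = Th.
Proof.
move=> VE uV n0; have uVn : V ^+ n \is a GRing.unit by rewrite unitrX.
have VnE : \prod_j F j ^+ n * (P ^+ (n - 1) * P) = V ^+ n.
  by rewrite VE exprMn -prodrXl -exprSr subn1 prednK.
transitivity (Th * (V ^+ n)^-1 * (\prod_j F j ^+ n * (P ^+ (n - 1) * P))).
  by set H := P ^+ _; set J := (V ^+ n)^-1; set G := \prod_j _; ring.
by rewrite VnE mulrVK.
Qed.

(** After clearing denominators, exponents are compared for each s < kappa. The truncated
    differences pair off, as those of x and -x differ by x: n - s against m - (kappa - s) = s - n
    leaves n - s, and n - (kappa - s) = s - m against m - s leaves s - m. The total n - m is the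
    difference of the exponents in the two denominators. *)
Lemma theta_product_sym m n : (0 < m)%N -> (0 < n)%N ->
  theta_product n (m + n) = theta_product m (m + n).
Proof.
move=> m0 n0; have [K KE] : exists K, (m + n)%N = K.+1 by exists (m + n).-1; lia.
pose A s := qpoch_inf (q ^+ s) (q ^+ K.+1).
have uA j : A j.+1 \is a GRing.unit by apply: qpoch_inf_unit.
have main l : (0 < l)%N -> (l <= K.+1)%N ->
    theta_product l (m + n) * A K.+1 * \prod_(j < K) A j.+1 ^+ l =
    \prod_(j < K) A j.+1 ^+ (l - j.+1 + (l - (K - j))).
  move=> l0 lK; rewrite -(prod_theta lK) KE theta_product_ord.
  apply: div_expn_cancel_prod => //; first exact: qpoch_inf_qq.
  exact: qpoch_inf_qq_unit.
have up l : \prod_(j < K) A j.+1 ^+ l \is a GRing.unit.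
  by apply: rpred_prod => j _; rewrite unitrX.
have u1 : A K.+1 * ((\prod_(j < K) A j.+1 ^+ n) * \prod_(j < K) A j.+1 ^+ m) \is a
  GRing.unit.
  by rewrite !unitrM !up (uA K).
have [nK mK] : (n <= K.+1)%N /\ (m <= K.+1)%N by lia.
apply: (mulIr u1); rewrite !mulrA (main n) // (mulrAC (theta_product m _ * _)) (main m) //.
rewrite -!big_split; apply: eq_bigr => j _ /=; rewrite -!exprD; congr (_ ^+ _).
by have := ltn_ord j; lia.
Qed.

End ProductIdentities.

(** * The limit *)

Lemma inO_qXnMl (K : fieldType) e M (x : {fraction (fps K)}) :
  inO (e + M) (tofrac (fps_q K) ^+ e * x) -> inO M x.
Proof.
move=> [f fE]; exists f; apply: (mulfI (expf_neq0 e (tofrac_q_neq0 K))).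
by rewrite fE exprD -mulrA rmorphM rmorphXn.
Qed.

Section Limits.
Variables (m n : nat).
Hypotheses (m_gt0 : (0 < m)%N) (n_gt0 : (0 < n)%N).
Local Notation q := (fps_q rat).
Local Notation Q := (tofrac q).
Local Notation kappa := (m + n)%N.

Definition weight_sum beta l r : {fraction (fps rat)} :=
  \sum_(k : {ffun 'I_n -> 'I_r.+1} | compositions k) string_weight Q beta l (fun c => k c).

Definition num_sum beta l r : {fraction (fps rat)} :=
  \sum_(k : {ffun 'I_n -> 'I_r.+1} | compositions k)
    string_weight Q beta l (fun c => k c) * string_den beta Q (fun c => k c).

(** The source of the [F r] in the theorem: q^(m C(r, 2)) can be divided out within power series. *)
Lemma inO_weight_sum r : inO (m * 'C(r, 2)) (weight_sum n m r).
Proof.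
apply: inO_sum => k /eqP kr.
by apply: inO_leq _ (inO_string_weight rat (leqnn n) m (Ordinal n_gt0) kr);
  rewrite leq_addr.
Qed.

Lemma inO_weight_num_sum beta l M r : (n <= beta)%N -> (0 < beta)%N ->
  (M + beta * M.+1 <= r)%N ->
  inO (l * 'C(r, 2) + M)
    (weight_sum beta l r * tofrac (string_den_inf rat n beta) - num_sum beta l r).
Proof.
move=> nb b0 rbig; rewrite mulr_suml -sumrB; apply: inO_sum => k /eqP kr.
by rewrite -mulrBr; apply: inO_num_defect.
Qed.

Lemma hl_principal_weight_sum r F :
  weight_sum n m r = tofrac (q ^+ (m * 'C(r, 2)) * F) ->
  q ^+ (m * 'C(r, 2)) * F = hl_principal (nseq r m) n.
Proof.
move=> FE; symmetry; apply: fps_cvg_lim; apply: fps_cvg_qdvd => M.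
(* [inO_string_term] asks every string to end at n (r + 1) + M or later, and each of them ends at N
   or later. *)
exists (r + n * r.+1 + M)%N => N Nbig; apply/inO_tofrac; rewrite rmorphB /= -FE.
have rN : (r <= N)%N by lia.
rewrite (hl_spec_string rN m_gt0 n_gt0) -sumrB; apply: inO_sum => k /eqP kr.
apply: (@inO_string_term rat n n (leqnn n) n_gt0 m (fun c => k c) _ M r kr) => d.
have := string_len_ltn N n_gt0 d (string_len N d); rewrite ltnn => /esym/negbT.
by rewrite -leqNgt; lia.
Qed.

(** Modulo q^M, [F * D1] is [A] and [D2] is [p * A]; eliminating [A] gives [p * (F * D1)] congruent
    to [D2]. With [p] replaced by its limit [P], the unit [D1 * P] can be divided out, and
    [theta_product_den_inf] identifies the quotient. *)
Lemma qdvd_weight_sum_sub_theta r M F :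
  weight_sum n m r = tofrac (q ^+ (m * 'C(r, 2)) * F) ->
  (M + kappa * M.+1 <= r)%N -> qdvd M (F - theta_product n kappa).
Proof.
move=> FE rbig; have k0 : (0 < kappa)%N by lia.
pose D1 := string_den_inf rat n n; pose D2 := string_den_inf rat n kappa.
pose P := qpoch_inf (q ^+ kappa) (q ^+ kappa); pose p := qpoch (q ^+ kappa) (q ^+ kappa) r.
pose A := num_sum kappa 0 r.
have e1 : inO M (tofrac (F * D1) - A).
  apply: (@inO_qXnMl rat (m * 'C(r, 2))).
  have -> : Q ^+ (m * 'C(r, 2)) * (tofrac (F * D1) - A) =
      weight_sum n m r * tofrac D1 - num_sum n m r.
    have -> : num_sum n m r = Q ^+ (m * 'C(r, 2)) * A.
      exact: (string_num_eq n (tofrac_q_neq0 rat) (@tofrac_q_expn_neq1 rat) m r).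
    by rewrite FE mulrBr; congr (_ - _); rewrite -rmorphXn -!rmorphM mulrA.
  by apply: inO_weight_num_sum => //; nia.
have e2 : inO M (tofrac D2 - tofrac p * A).
  have -> : tofrac D2 - tofrac p * A =
      tofrac p * (weight_sum kappa 0 r * tofrac D2 - num_sum kappa 0 r).
    have pS : tofrac p * weight_sum kappa 0 r = 1.
      rewrite rmorph_qpoch !rmorphXn.
      exact: (sum_string_weight0 rat r (leq_addl m n) n_gt0).
    by rewrite mulrBr mulrA pS mul1r.
  rewrite -[M]add0n; apply: inOM; first exact: inO_tofrac0.
  by have := @inO_weight_num_sum kappa 0 M r (leq_addl m n) k0 rbig; rewrite mul0n add0n.
have e3 : qdvd M (p * (F * D1) - D2).
  apply/inO_tofrac; rewrite rmorphB rmorphM.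
  have split (x y z w : {fraction (fps rat)}) :
      x * y - z = x * (y - w) + (- 1) * (z - x * w) by ring.
  rewrite (split _ _ _ A).
  apply: inOD; rewrite -[M]add0n; apply: inOM => //; first exact: inO_tofrac0.
  by exists (- 1); rewrite expr0 mul1r rmorphN rmorph1.
have e4 : qdvd M (P - p).
  by apply/qdvd_subC/(@qdvd_leq _ _ r); [nia | exact: qdvd_qpoch].
have uD : D1 \is a GRing.unit.
  by rewrite /D1 string_den_inf_same // unitrX // qpoch_inf_qq_unit.
have uP : P \is a GRing.unit := qpoch_inf_unit rat k0 k0.
have u : D1 * P \is a GRing.unit by rewrite unitrM uD uP.
have split (f x y z w : fps rat) : f * (x * y) - w = z * (f * x) - w + (y - z) * (f * x).
  by ring.
have e5 : qdvd M ((F - theta_product n kappa) * (D1 * P)).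
  rewrite mulrBl (theta_product_den_inf n_gt0 k0) (split F D1 P p D2).
  by apply: qdvdD => //; apply: qdvdMr.
by have := qdvdMr (D1 * P)^-1 e5; rewrite mulrK.
Qed.

End Limits.

(* [F r] is the power series q^(-m * C(r, 2)) P_(m^r)(1, q, q^2, ...; q^n). *)
Theorem theorem1p5 (m n : nat) (hm : (0 < m)%N) (hn : (0 < n)%N) :
  let kappa := (m + n)%N in
  exists F : nat -> fps rat,
    [/\ forall r : nat,
          fps_q rat ^+ (m * 'C(r, 2)) * F r = hl_principal (nseq r m) n,
        fps_cvg F (theta_product n kappa)
      & theta_product n kappa = theta_product m kappa].
Proof.
move=> kappa; have [F FE] := boolp.choice (inO_weight_sum m hn).
exists F; split=> [r||]; last exact: theta_product_sym.
  exact: hl_principal_weight_sum (FE r).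
apply: fps_cvg_qdvd => M; exists (M + kappa * M.+1)%N => r rbig.
exact: qdvd_weight_sum_sub_theta (FE r) rbig.
Qed.
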